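(* Let $d\ge 1$ and let $T$ be a linear operator on $L^2(\mathbb{R}^d)\cap L^\infty(\mathbb{R}^d)$ which is a contraction with respect to $\|\cdot\|_\infty$ and is bounded with respect to $\|\cdot\|_2$. Then $\Gamma_2(T)$ is a self-adjoint operator on the quadratic Fock space $\Gamma_2(L^2(\mathbb{R}^d)\cap L^\infty(\mathbb{R}^d))$ if and only if there exist a measurable subset $E\subset\mathbb{R}^d$, a measurable function $h:\mathbb{R}^d\to\mathbb{C}$ with $\|h\|_\infty\le 1$, and an involutive, measurable, Lebesgue measure preserving function $\varphi:E\to E$ such that $\overline{h(x)}=h(\varphi(x))$ for a.e. $x\in E$ and $$T(f)=\chi_E\, h\, (f\circ\varphi)\quad\text{a.e.}$$ for all $f\in L^2(\mathbb{R}^d)\cap L^\infty(\mathbb{R}^d)$, where $\chi_E$ is the characteristic function of $E$ (so the right-hand side is understood to be $0$ outside $E$).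
   Context: All function spaces consist of complex-valued functions modulo a.e. equality for Lebesgue measure on $\mathbb{R}^d$, and $\langle f,g\rangle=\int_{\mathbb{R}^d}\overline{f(s)}g(s)\,ds$. Fix a constant $c>0$. Quadratic Fock space. $\Gamma_2(L^2(\mathbb{R}^d)\cap L^\infty(\mathbb{R}^d))$ is the Hilbert space which is the closed linear span of vectors $B^{+n}_f\Phi$, $n\in\mathbb{N}$, $f\in L^2(\mathbb{R}^d)\cap L^\infty(\mathbb{R}^d)$, where $B_f^{+0}\Phi=\Phi$ is a unit vector, vectors with different $n$ are orthogonal, and for $n\ge1$ $$\langle B^{+n}_f\Phi,B^{+n}_g\Phi\rangle=c\sum_{k=0}^{n-1}2^{2k+1}\frac{n!(n-1)!}{((n-k-1)!)^2}\langle f^{k+1},g^{k+1}\rangle\langle B^{+(n-k-1)}_f\Phi,B^{+(n-k-1)}_g\Phi\rangle .$$ Quadratic exponential vectors. For $f\in L^2(\mathbb{R}^d)\cap L^\infty(\mathbb{R}^d)$ with $\|f\|_\infty<\frac12$, the vector $\Psi(f)=\sum_{n\ge0}\frac{1}{n!}B_f^{+n}\Phi$ exists (with $\Psi(0)=\Phi$), and $$\langle\Psi(f),\Psi(g)\rangle=\exp\Big(-\frac c2\int_{\mathbb{R}^d}\ln\big(1-4\overline{f(s)}g(s)\big)\,ds\Big).$$ These vectors are linearly independent and total, so this formula determines the space up to unitary equivalence. Quadratic quantization. For a linear operator $T$ on $L^2(\mathbb{R}^d)\cap L^\infty(\mathbb{R}^d)$ that is a contraction for $\|\cdot\|_\infty$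 (i.e. $\|Tf\|_\infty\le\|f\|_\infty$), $\Gamma_2(T)$ is the linear operator determined by $\Gamma_2(T)\Psi(f)=\Psi(Tf)$ for all $f$ with $\|f\|_\infty<\frac12$, initially defined on the (dense) linear span of these exponential vectors. ''$\Gamma_2(T)$ is a self-adjoint operator'' means that this densely defined operator is closable and its closure (its bounded extension, when it is bounded) is self-adjoint. *)

(* Defs.v *)
From HB Require Import structures.
From mathcomp Require Import all_boot all_order all_algebra.
From mathcomp Require Import sesquilinear complex.
From mathcomp Require Import all_classical all_reals all_analysis.

Set Implicit Arguments.
Unset Strict Implicit.
Unset Printing Implicit Defensive.

Import Order.TTheory GRing.Theory Num.Theory.
Import numFieldNormedType.Exports.

Local Open Scope classical_set_scope.
Local Open Scope ring_scope.

Section euclidean_space.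
Context (R : realType).

(* R^d with its Borel sigma-algebra (the one generated by the coordinates).
   A Lebesgue measurable set or function agrees a.e. with a Borel one. *)
Definition euclidean (d : nat) := d.-tuple (measurableTypeR R).
HB.instance Definition _ d := Measurable.on (euclidean d).

Definition cons_euclidean n (p : measurableTypeR R * euclidean n) :
  euclidean n.+1 := [tuple of p.1 :: p.2].

Lemma measurable_cons_euclidean n :
  measurable_fun [set: measurableTypeR R * euclidean n] (@cons_euclidean n).
Proof. exact: measurable_cons. Qed.

Section step.
Context (n : nat) (m : {sigma_finite_measure set (euclidean n) -> \bar R}).

Definition leb_step : set (euclidean n.+1) -> \bar R :=
  pushforward (@lebesgue_measure R \x m)%E (@cons_euclidean n).

Let leb_step0 : leb_step set0 = 0%E.
Proof. by rewrite /leb_step /pushforward preimage_set0 measure0. Qed.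

Let leb_step_ge0 A : (0 <= leb_step A)%E.
Proof. by rewrite /leb_step /pushforward; exact: measure_ge0. Qed.

Let leb_step_sigma_additive : semi_sigma_additive leb_step.
Proof.
have mcons A : measurable A -> measurable (@cons_euclidean n @^-1` A).
  by move=> mA; rewrite -[X in measurable X]setTI; exact: measurable_cons_euclidean.
move=> F mF tF mUF; rewrite /leb_step /pushforward preimage_bigcup.
apply: measure_semi_sigma_additive => [k||]; first exact: mcons.
- apply/trivIsetP => i j _ _ ij; rewrite -preimage_setI.
  by move/trivIsetP : tF => /(_ _ _ _ _ ij) ->//; rewrite preimage_set0.
- by rewrite -preimage_bigcup; exact: mcons.
Qed.

HB.instance Definition _ := isMeasure.Build _ _ _ leb_step
  leb_step0 leb_step_ge0 leb_step_sigma_additive.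

Lemma leb_step_cons A B : measurable A -> measurable B ->
  leb_step [set t | A (thead t) /\ B [tuple of behead t]] =
  (@lebesgue_measure R A * m B)%E.
Proof.
move=> mA mB; rewrite -product_measure1E// /leb_step /pushforward.
congr ((_ \x _)%E _); apply/seteqP; split=> -[x t] /=; rewrite theadE.
  by rewrite (_ : [tuple of _] = t)//; exact/val_inj.
by move=> [? ?]; split => //; rewrite (_ : [tuple of _] = t)//; exact/val_inj.
Qed.

Let leb_step_sigma_finite : sigma_finite setT leb_step.
Proof.
have /sigma_finiteP[F [TF ndF Foo]] := sigma_finiteT (@lebesgue_measure R).
have /sigma_finiteP[G [TG ndG Goo]] := sigma_finiteT m.
exists (fun k => [set t | F k (thead t) /\ G k [tuple of behead t]]).
  apply/seteqP; split=> // t _.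
  have [i _ Fi] : (\bigcup_k F k) (thead t) by rewrite -TF.
  have [j _ Gj] : (\bigcup_k G k) [tuple of behead t] by rewrite -TG.
  exists (maxn i j) => //; split.
    by move: Fi; exact/subsetPset/ndF/leq_maxl.
  by move: Gj; exact/subsetPset/ndG/leq_maxr.
move=> k; have [mF Fk] := Foo k; have [mG Gk] := Goo k; split.
  apply: measurableI; rewrite -[X in measurable X]setTI.
    exact: measurable_tnth.
  exact: measurable_behead.
by rewrite leb_step_cons// lte_mul_pinfty// ge0_fin_numE.
Qed.

HB.instance Definition _ := Measure_isSigmaFinite.Build _ _ _ leb_step
  leb_step_sigma_finite.

End step.

Fixpoint lebesgue_euclidean (d : nat) :
    {sigma_finite_measure set (euclidean d) -> \bar R} :=
  if d is n.+1 then leb_step (lebesgue_euclidean n)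
  else \d_([tuple] : euclidean 0).

End euclidean_space.

Section function_spaces.
Context (R : realType) (d : nat).
Local Notation C := R[i].
Local Notation X := (euclidean R d).
Local Notation mu := (lebesgue_euclidean R d).
Implicit Types f g : X -> C.

Definition measurable_cfun f :=
  measurable_fun [set: X] (fun x => complex.Re (f x)) /\
  measurable_fun [set: X] (fun x => complex.Im (f x)).

Definition cnorm (p : \bar R) f : \bar R :=
  Lnorm mu p (fun x => (Normc.normc (f x))%:E).

(* Elements of L^2 /\ L^oo are represented by everywhere defined (Borel)
   functions, which are to be compared up to a.e. equality. *)
Definition L2Linf f :=
  [/\ measurable_cfun f, (cnorm 2%:E f < +oo)%E & (cnorm +oo%E f < +oo)%E].

Definition cintegral f : C :=
  Complex (\int[mu]_x complex.Re (f x)) (\int[mu]_x complex.Im (f x)).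

Definition L2inner f g : C := cintegral (fun x => conjc (f x) * g x).

(* A linear operator on the a.e. classes of L^2 /\ L^oo, acting on
   representatives; its values outside L^2 /\ L^oo are irrelevant. *)
Definition L2Linf_operator (T : (X -> C) -> (X -> C)) :=
  [/\ forall f, L2Linf f -> L2Linf (T f),
      forall f g, L2Linf f -> L2Linf g ->
        f = g %[ae mu] -> T f = T g %[ae mu] &
      forall (a : C) f g, L2Linf f -> L2Linf g ->
        T (fun x => a * f x + g x) = (fun x => a * T f x + T g x) %[ae mu]].

Definition Linf_contraction (T : (X -> C) -> (X -> C)) :=
  forall f, L2Linf f -> (cnorm +oo%E (T f) <= cnorm +oo%E f)%E.

Definition L2_bounded (T : (X -> C) -> (X -> C)) :=
  exists M : R, forall f, L2Linf f ->
    (cnorm 2%:E (T f) <= M%:E * cnorm 2%:E f)%E.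

Definition involution_on (E : set X) (phi : X -> X) :=
  set_fun E E phi /\ forall x, E x -> phi (phi x) = x.

Definition measure_preserving_on (E : set X) (phi : X -> X) :=
  forall A, measurable A -> A `<=` E -> mu (E `&` phi @^-1` A) = mu A.

End function_spaces.

Definition lspan (K : pzRingType) (V : lmodType K) (A : set V) : set V :=
  [set v | exists n (a : 'I_n -> K) (u : 'I_n -> V),
     (forall i, A (u i)) /\ v = \sum_(i < n) a i *: u i].

(* An unbounded operator on H is given by its graph, a subset of H * H. *)
Section operators.
Context (R : realType) (H : completeNormedModType R[i]).
Context (dot : {dot H for Num.conj}).
Implicit Types G : set (H * H)%type.

(* [dot] is linear in its first argument, [inner] in its second one. *)
Definition inner (u v : H) : R[i] := dot v u.

(* With completeness of H, this makes (H, inner) a Hilbert space. *)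
Definition inner_norm := forall u : H, `|u| ^+ 2 = inner u u.

Definition single_valued G := forall u v w, G (u, v) -> G (u, w) -> v = w.

Definition densely_defined G := closure [set u | exists v, G (u, v)] = setT.

Definition closable G := single_valued (closure G : set (H * H)%type).

Definition adjoint G : set (H * H)%type :=
  [set p | forall u v, G (u, v) -> inner p.1 v = inner p.2 u].

Definition self_adjoint G :=
  [/\ single_valued G, densely_defined G & adjoint G = G].

Definition essentially_self_adjoint G :=
  [/\ densely_defined G, closable G & self_adjoint (closure G)].

End operators.

Section fock.
Context (R : realType) (d : nat) (H : completeNormedModType R[i]).
Context (dot : {dot H for Num.conj}).
Local Notation C := R[i].
Local Notation X := (euclidean R d).

(* [B n f] stands for the vector B_f^{+n} Phi.  The inner products below
   determine H and the map B up to unitary equivalence. *)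
Record quadratic_fock (c : R) (Phi : H) (B : nat -> (X -> C) -> H) : Prop := {
  fock_inner_norm : inner_norm dot;
  fock_vacuum_unit : `|Phi| = 1;
  fock_vacuum : forall f, L2Linf f -> B 0%N f = Phi;
  fock_orthogonal : forall m n f g, L2Linf f -> L2Linf g -> m != n ->
    inner dot (B m f) (B n g) = 0;
  fock_inner : forall n f g, (1 <= n)%N -> L2Linf f -> L2Linf g ->
    inner dot (B n f) (B n g) =
    real_complex R c * \sum_(0 <= k < n)
      (2 ^+ (2 * k + 1) * (n`! * (n - 1)`!)%:R / ((n - k - 1)`! ^ 2)%:R
       * L2inner (fun x => f x ^+ k.+1) (fun x => g x ^+ k.+1)
       * inner dot (B (n - k - 1)%N f) (B (n - k - 1)%N g));
  fock_total :
    closure (lspan [set v | exists n f, L2Linf f /\ v = B n f]) = setT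
}.

Variable B : nat -> (X -> C) -> H.

Definition expvec (f : X -> C) : H :=
  limn (series (fun n => n`!%:R^-1 *: B n f)).

(* Graph of Gamma_2(T) on the span of the exponential vectors: the linear
   span of the pairs (Psi(f), Psi(T f)). *)
Definition Gamma2 (T : (X -> C) -> (X -> C)) : set (H * H)%type :=
  lspan [set p : (H * H)%type | exists f, [/\ L2Linf f,
     (cnorm +oo%E f < (2^-1)%:E)%E & p = (expvec f, expvec (T f))]].

End fock.

(* Main.v *)
Require Import Defs.
From HB Require Import structures.
From mathcomp Require Import all_boot all_order all_algebra.
From mathcomp Require Import sesquilinear complex.
From mathcomp Require Import all_classical all_reals all_analysis.
From mathcomp Require Import measurable_realfun ess_sup_inf ring lra.

(* The closure of the graph of Gamma_2(T) is also the closed span of the pairs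
   (B_f^n Phi, B_(Tf)^n Phi): these pairs are the coefficients of the power
   series s |-> (Psi(sf), Psi(T(sf))).

   If T f = chi_E h (f o phi), then <f^k, (Tg)^k> = <(Tf)^k, g^k> for all k >= 1,
   so the recursion for the inner products makes Gamma_2(T) symmetric.  Moreover
   the vectors B_(T^j f)^n Phi stay bounded in j, and a symmetric operator A for
   which the sequences |A^j v| are bounded is a contraction, because |A^j v|^2
   is convex in j.  Hence the closure is self-adjoint.

   Conversely, self-adjointness gives <f, Tg> = <Tf, g> and
   <f^2, (Tg)^2> = <(Tf)^2, g^2>.  Polarizing the latter, Tg1 Tg2 only depends
   on g1 g2.  For a fixed weight w > 0 this makes f |-> T(fw) / Tw multiplicative,
   so it maps indicator functions to indicator functions, and the induced
   homomorphism of sigma-algebras comes from a point map phi whose coordinates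
   are read off from the half-spaces.  Then T f = h (f o phi), and the two
   symmetry relations force h o phi = conj h, the invariance of the Lebesgue
   measure on {h <> 0}, and phi o phi = id there. *)

Set Implicit Arguments.
Unset Strict Implicit.
Unset Printing Implicit Defensive.

Import Order.TTheory GRing.Theory Num.Theory.
Import numFieldNormedType.Exports.

Local Open Scope classical_set_scope.
Local Open Scope ring_scope.

(** * Closed subspaces of normed modules *)

(** Two obstacles shape the sufficiency. Exponential vectors are available only for sup norm below
    1/2, whereas number vectors scale freely, which is why the graph is rewritten in terms of them.
    And no bound on [Gamma2 B T] is given in advance: it comes from a growth estimate for number
    vectors whose constant depends on [f] only through bounds for [|f|^2] and its integral. A
    weighted composition with [|h| <= 1] increases neither, so a single constant serves all iterates
    of [T].

    In the converse, first order symmetry sees only the linear structure of functions;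
    multiplicativity comes from the squares, hence from [n = 2]. The natural multiplier would be
    [T 1], but constants need not be square integrable. A strictly positive weight [w <= 1] in L^2
    stands in for 1, and quotients by [w] are avoided, since they may leave the space, by
    rearranging products. The point map carries information only where [T w] does not vanish, and
    every identity holds only up to a null set; the final set [E] is therefore trimmed so that the
    involution is exact on it. *)

Section complex_reals.
Context {R : realType}.
Local Open Scope complex_scope.
Implicit Types (z e : R[i]) (r : R).

(** In [R[i]] comparable numbers have equal imaginary parts, so the positive radii occurring in the
    topology of [H] are real. *)
Lemma gt0_complexE e : 0 < e -> exists2 r, 0 < r & e = r%:C.
Proof.
by case: e => a b; rewrite ltcE /= => /andP[/eqP -> a0]; exists a.
Qed.

Lemma ge0_complexE e : 0 <= e -> exists2 r, 0 <= r & e = r%:C.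
Proof.
by case: e => a b; rewrite lecE /= => /andP[/eqP -> a0]; exists a.
Qed.

End complex_reals.

Section normed_modules.
Context {K : numFieldType}.

Lemma closure_normP (V : normedModType K) (A : set V) (x : V) :
  closure A x <-> forall e : K, 0 < e -> exists2 y, A y & `|x - y| < e.
Proof.
split=> [Ax e e0|h U /nbhs_ballP[e /= e0 eU]].
  have [y [Ay]] := Ax _ (nbhsx_ballx x e e0).
  by rewrite -ball_normE /= => xy; exists y.
have [y Ay xy] := h e e0; exists y; split => //; apply: eU.
by rewrite -ball_normE.
Qed.

Definition linear_subspace (V : lmodType K) (W : set V) :=
  W 0 /\ forall (a : K) u v, W u -> W v -> W (a *: u + v).

Section linear_subspace.
Context (V : lmodType K) (W : set V) (sW : linear_subspace W).

Lemma linear_subspace0 : W 0. Proof. by case: sW. Qed.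

Lemma linear_subspaceZ a u : W u -> W (a *: u).
Proof. by case: sW => W0 h Wu; rewrite -[a *: u]addr0; exact: h. Qed.

Lemma linear_subspaceD u v : W u -> W v -> W (u + v).
Proof. by case: sW => W0 h Wu Wv; rewrite -[u]scale1r; exact: h. Qed.

Lemma linear_subspaceB u v : W u -> W v -> W (u - v).
Proof. by case: sW => W0 h Wu Wv; rewrite addrC -scaleN1r; exact: h. Qed.

Lemma linear_subspace_sum (I : Type) (s : seq I) (P : pred I) (u : I -> V) :
  (forall i, P i -> W (u i)) -> W (\sum_(i <- s | P i) u i).
Proof.
move=> h; elim/big_rec : _ => [|i x Pi Wx]; first exact: linear_subspace0.
by apply: linear_subspaceD => //; exact: h.
Qed.

End linear_subspace.

Lemma linear_subspace_lspan (V : lmodType K) (A : set V) :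
  linear_subspace (lspan A).
Proof.
split; first by exists 0%N, (fun=> 0), (fun=> 0); split=> [[]//|]; rewrite big_ord0.
move=> c _ _ [m [a [u [Au ->]]]] [n [b [v [Av ->]]]].
exists (m + n)%N, (fun i => match fintype.split i with inl j => c * a j | inr j => b j end),
  (fun i => match fintype.split i with inl j => u j | inr j => v j end); split.
  by move=> i; case: fintype.split.
rewrite big_split_ord /= scaler_sumr; congr (_ + _); apply: eq_bigr => i _.
  by have /= -> := @unsplitK m n (inl i); rewrite scalerA.
by have /= -> := @unsplitK m n (inr i).
Qed.

Lemma sub_lspan (V : lmodType K) (A : set V) : A `<=` lspan A.
Proof.
move=> v Av; exists 1%N, (fun=> 1), (fun=> v).
by split=> //; rewrite big_ord1 scale1r.
Qed.

Lemma lspan_sub (V : lmodType K) (A W : set V) :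
  linear_subspace W -> A `<=` W -> lspan A `<=` W.
Proof.
move=> sW AW _ [n [a [u [Au ->]]]]; apply: (linear_subspace_sum sW) => i _.
by apply: (linear_subspaceZ sW); exact/AW.
Qed.

Lemma linear_subspace_closure (V : normedModType K) (W : set V) :
  linear_subspace W -> linear_subspace (closure W).
Proof.
move=> sW; split; first by apply: subset_closure; exact: (linear_subspace0 sW).
move=> a u v /closure_normP Wu /closure_normP Wv; apply/closure_normP => e e0.
have [u' Wu' uu'] := Wu (e / 2 / (1 + `|a|))
  (divr_gt0 (divr_gt0 e0 (ltr0Sn _ _)) (ltr_pwDl ltr01 (normr_ge0 a))).
have [v' Wv' vv'] := Wv (e / 2) (divr_gt0 e0 (ltr0Sn _ _)).
exists (a *: u' + v').
  by apply: (linear_subspaceD sW) => //; exact: (linear_subspaceZ sW).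
rewrite opprD addrACA -scalerBr (le_lt_trans (ler_normD _ _))//.
rewrite (splitr e) normrZ ler_ltD//.
have a1 : 0 < 1 + `|a| by rewrite ltr_pwDl.
rewrite ltr_pdivlMr// in uu'; apply: le_trans (ltW uu').
by rewrite mulrC ler_wpM2l// lerDr.
Qed.

(* The coefficients of a power series are recovered one after the other:
   divide the remainder by [s ^+ n] and let [s] tend to 0. *)
Lemma coef_mem_closure (V : normedModType K) (W : set V) (u : V^nat)
    (M : K) (L : K -> V) :
  linear_subspace W ->
  (forall n, \sum_(k < n) `|u k| <= M) ->
  (forall s, 0 < s -> s < 1 ->
     series (fun n => s ^+ n *: u n) n @[n --> \oo] --> L s) ->
  (forall s, 0 < s -> s < 1 -> closure W (L s)) ->
  forall n, closure W (u n).
Proof.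
move=> sW uM cvL WL; have sWc := linear_subspace_closure sW.
have M0 : 0 <= M by have := uM 0%N; rewrite big_ord0.
elim/ltn_ind => n IH.
suff : closure (closure W) (u n) by rewrite -(proj1 (closure_id _) (@closed_closure _ _)).
apply/closure_normP => e e0.
have M1 : 0 < 1 + M by rewrite ltr_pwDl.
(* The factor [1 + M] yields [s * (1 + M) < e]; the factor [1 + e] yields [s < 1] however large [e]
   is. *)
pose s := e / ((1 + M) * (1 + e)); have e1 : 0 < 1 + e by rewrite addr_gt0.
have s0 : 0 < s by rewrite divr_gt0// mulr_gt0.
have sge0 := ltW s0.
have sM : s * (1 + M) < e.
  rewrite /s invfM mulrA mulrAC mulfVK ?gt_eqF// ltr_pdivrMr//.
  by rewrite mulrDr mulr1 ltrDl mulr_gt0.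
have s1 : s < 1.
  rewrite ltr_pdivrMr ?mulr_gt0// mul1r mulrDl mul1r (lt_le_trans (_ : e < 1 + e))//.
    by rewrite ltrDr.
  by rewrite lerDl mulr_ge0// ltW.
exists (s ^- n *: (L s - \sum_(k < n) s ^+ k *: u k)).
  apply: (linear_subspaceZ sWc); apply: (linear_subspaceB sWc); first exact: WL.
  by apply: (linear_subspace_sum sWc) => k _; apply: (linear_subspaceZ sWc); exact: IH.
have /cvgrPdist_lt/(_ (s ^+ n.+1) (exprn_gt0 _ s0)) := cvL s s0 s1.
case=> N _ /(_ (maxn N n.+1) (leq_maxl _ _)).
set m := maxn N n.+1; rewrite seriesEnat /= => Lm.
have nm : (n < m)%N by rewrite leq_maxr.
have sn0 : s ^+ n != 0 by rewrite expf_neq0// gt_eqF.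
(* As [n < m], the partial sum contains the term of index [n]. What remains is the distance from
   [L s] to that partial sum, below [s ^+ n.+1], and the terms of index from [n.+1] to [m - 1], at
   most [s ^+ n.+1 * M] together. *)
have -> : u n - s ^- n *: (L s - \sum_(k < n) s ^+ k *: u k) =
    s ^- n *: (- (L s - \sum_(0 <= k < m) s ^+ k *: u k)
               - \sum_(n.+1 <= k < m) s ^+ k *: u k).
  rewrite (@big_cat_nat _ _ _ n.+1 0%N m)//= big_nat_recr//= big_mkord.
  set S1 := \sum_(i < n) _; set S2 := \sum_(_ <= i < _) _.
  rewrite -{1}[u n]scale1r -(mulVf sn0) -scalerA -scalerBr; congr (_ *: _).
  by rewrite !opprB [RHS]addrAC addrK addrCA addrA.
rewrite normrZ ger0_norm ?invr_ge0 ?exprn_ge0// mulrC.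
rewrite ltr_pdivrMr ?exprn_gt0// mulrC.
apply: le_lt_trans (ler_normB _ _) _; rewrite normrN.
apply: (@lt_trans _ _ (s ^+ n * (s * (1 + M)))); last by rewrite ltr_pM2l// exprn_gt0.
rewrite mulrA -exprSr mulrDr mulr1 ltr_leD//.
apply: le_trans (ler_norm_sum _ _ _) _.
apply: (@le_trans _ _ (s ^+ n.+1 * \sum_(n.+1 <= k < m) `|u k|)).
  rewrite mulr_sumr; apply: ler_sum_nat => k /andP[nk _].
  rewrite normrZ ger0_norm ?exprn_ge0// ler_wpM2r//.
  by rewrite ler_wiXn2l// ltW.
rewrite ler_wpM2l ?exprn_ge0//; apply: le_trans (uM m).
rewrite -(big_mkord xpredT (fun k => `|u k|)) (@big_cat_nat _ _ _ n.+1 0%N m)//=.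
by rewrite lerDr sumr_ge0.
Qed.

End normed_modules.

(** * Bounded symmetric relations in a Hilbert space *)

(** Convexity makes the increments nondecreasing, so a positive first increment would force linear
    growth. *)
Lemma bounded_convex_le {R : archiRealFieldType} (x : nat -> R) (M : R) :
  (forall k, x k.+1 *+ 2 <= x k + x k.+2) -> (forall k, x k <= M) -> x 1%N <= x 0%N.
Proof.
move=> cx xM; rewrite leNgt; apply/negP => x01.
pose e := x 1%N - x 0%N; have e0 : 0 < e by rewrite subr_gt0.
have inc k : e <= x k.+1 - x k.
  elim: k => // k /le_trans; apply.
  by have := cx k; rewrite mulr2n; lra.
have lin k : x 0%N + k%:R * e <= x k.
  elim: k => [|k IH]; first by rewrite mul0r addr0.
  by have := inc k; rewrite -natr1 mulrDl mul1r; move: IH; lra.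
have [k /ltW Mk] : exists k, (M - x 0%N) / e < k%:R :> R.
  exists (Num.bound ((M - x 0%N) / e)); apply: archi_boundP.
  by apply: divr_ge0 (ltW e0); rewrite subr_ge0.
have := le_trans (lin k.+1) (xM k.+1).
move: Mk; rewrite ler_pdivrMr// -natr1 mulrDl mul1r.
by move: e0; lra.
Qed.

Section inner_product.
Context {R : realType} (H : completeNormedModType R[i]).
Context (dot : {dot H for Num.conj}).
Local Open Scope complex_scope.
Local Notation "''[' u , v ]" := (inner dot u v).
Implicit Types u v : H.

Lemma inner_conj u v : '[v, u] = conjc '[u, v].
Proof. by rewrite /inner hermC expr0 mul1r. Qed.

Lemma innerDr u v w : '[u, v + w] = '[u, v] + '[u, w].
Proof. by rewrite /inner linearDl. Qed.

Lemma innerNr u v : '[u, - v] = - '[u, v].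
Proof. by rewrite /inner linearNl. Qed.

Lemma innerZr a u v : '[u, a *: v] = a * '[u, v].
Proof. by rewrite /inner linearZl_LR. Qed.

Lemma innerBr u v w : '[u, v - w] = '[u, v] - '[u, w].
Proof. by rewrite innerDr innerNr. Qed.

Lemma inner0r u : '[u, 0] = 0. Proof. by rewrite /inner linear0l. Qed.

Lemma inner_sumr (I : Type) (s : seq I) (P : pred I) (v : I -> H) u :
  '[u, \sum_(i <- s | P i) v i] = \sum_(i <- s | P i) '[u, v i].
Proof. exact: (big_morph _ (innerDr u) (inner0r u)). Qed.

Lemma innerDl u v w : '[u + v, w] = '[u, w] + '[v, w].
Proof. by rewrite inner_conj innerDr rmorphD /= -!inner_conj. Qed.

Lemma innerNl u v : '[- u, v] = - '[u, v].
Proof. by rewrite inner_conj innerNr rmorphN /= -!inner_conj. Qed.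

Lemma innerZl a u v : '[a *: u, v] = conjc a * '[u, v].
Proof. by rewrite inner_conj innerZr rmorphM /= -!inner_conj. Qed.

Lemma innerBl u v w : '[u - v, w] = '[u, w] - '[v, w].
Proof. by rewrite innerDl innerNl. Qed.

Lemma inner0l u : '[0, u] = 0. Proof. by rewrite inner_conj inner0r conjc0. Qed.

Lemma inner_suml (I : Type) (s : seq I) (P : pred I) (v : I -> H) u :
  '[\sum_(i <- s | P i) v i, u] = \sum_(i <- s | P i) '[v i, u].
Proof. exact: (big_morph (fun v => '[v, u]) (fun v w => innerDl v w u) (inner0l u)). Qed.

Hypothesis dotn : inner_norm dot.

Lemma inner_ge0 u : 0 <= '[u, u].
Proof. by rewrite -dotn exprn_ge0. Qed.

Lemma inner_eq0 u : '[u, u] = 0 -> u = 0.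
Proof. by rewrite -dotn => /eqP; rewrite sqrf_eq0 normr_eq0 => /eqP. Qed.

Lemma cauchy_schwarz u v : `|'[u, v]| <= `|u| * `|v|.
Proof.
have [->|v0] := eqVneq v 0; first by rewrite inner0r !normr0 mulr0.
have nv0 : 0 < `|v| by rewrite normr_gt0.
rewrite -(@ler_pM2r _ `|v|)// -(@ler_pXn2r _ 2) ?nnegrE ?mulr_ge0//.
(* This vector is [|v| ^+ 2] times the component of [u] orthogonal to [v], written without
   division. *)
have h := inner_ge0 (`|v| ^+ 2 *: u - '[v, u] *: v).
rewrite innerBl !innerBr !innerZl !innerZr -!dotn (inner_conj v u) in h.
have bb : conjc (`|v| ^+ 2) = `|v| ^+ 2.
  by have [r _ ->] := ge0_complexE (normr_ge0 v); rewrite -rmorphXn conjc_real.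
rewrite {}bb in h; set z := '[v, u] in h.
have zz : conjc z * z = `|'[u, v]| ^+ 2.
  by rewrite sqr_normc /z (inner_conj v u) conjcK.
set a := `|u| in h *; set b := `|v| in h nv0 *.
have : 0 <= b ^+ 2 * (a ^+ 2 * b ^+ 2 - conjc z * z).
  apply: le_trans h _; rewrite le_eqVlt; apply/orP; left; apply/eqP; ring.
rewrite pmulr_rge0 ?exprn_gt0// subr_ge0 zz => h'.
by rewrite exprMn [leRHS]exprMn ler_pM2r ?exprn_gt0// exprMn.
Qed.

(** Both sides are continuous in [(x, y)] by the Cauchy-Schwarz inequality, so a pair adjoint to [G]
    is adjoint to its closure. *)
Lemma inner_closure2 (G : set (H * H)) u v :
  (forall x y, G (x, y) -> '[u, y] = '[v, x]) ->
  forall x y, closure G (x, y) -> '[u, y] = '[v, x].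
Proof.
move=> h x y /closure_normP cl; apply/eqP; rewrite -subr_eq0 -normr_le0.
apply/ler_addgt0Pl => e e0; rewrite addr0.
have M0 : 0 < 1 + (`|u| + `|v|) by rewrite ltr_pwDl// addr_ge0.
have [[x' y'] Gxy] := cl _ (divr_gt0 e0 M0).
rewrite prod_normE /= ltr_pdivlMr// mulrC => /ltW xy.
have -> : '[u, y] - '[v, x] = '[u, y - y'] - '[v, x - x'].
  by rewrite !innerBr (h x' y')// opprB addrA subrK.
apply: le_trans xy; apply: le_trans (ler_normB _ _) _.
have hx : `|x - x'| <= Num.max `|x - x'| `|y - y'|.
  by rewrite comparable_le_max ?lexx// real_comparable ?normr_real.
have hy : `|y - y'| <= Num.max `|x - x'| `|y - y'|.
  by rewrite comparable_le_max ?lexx ?orbT// real_comparable ?normr_real.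
have m0 := le_trans (normr_ge0 (x - x')) hx.
rewrite mulrDl mul1r mulrDl ler_wpDl// lerD//.
  by rewrite (le_trans (cauchy_schwarz _ _))// ler_wpM2l.
by rewrite (le_trans (cauchy_schwarz _ _))// ler_wpM2l.
Qed.

Lemma inner_dense_eq0 (A : set H) u :
  closure A = setT -> (forall x, A x -> '[u, x] = 0) -> u = 0.
Proof.
move=> cA uA; apply: inner_eq0; apply/eqP; rewrite -normr_le0.
apply/ler_addgt0Pl => e e0; rewrite addr0.
have M0 : 0 < 1 + `|u| by rewrite ltr_pwDl.
have /closure_normP/(_ _ (divr_gt0 e0 M0))[x Ax] : closure A u by rewrite cA.
rewrite ltr_pdivlMr// => /ltW ux.
rewrite -[X in '[_, X]](subrK x) innerDr (uA x)// addr0.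
apply: le_trans ux; rewrite (le_trans (cauchy_schwarz _ _))// mulrC.
by rewrite ler_wpM2l// lerDr.
Qed.

End inner_product.

Section bounded_symmetric_relation.
Context {R : realType} (H : completeNormedModType R[i]).
Context (dot : {dot H for Num.conj}).
Hypothesis dotn : inner_norm dot.
Local Open Scope complex_scope.
Local Notation "''[' u , v ]" := (inner dot u v).

Definition symmetric_rel (G : set (H * H)) :=
  forall p q, G p -> G q -> '[p.1, q.2] = '[p.2, q.1].

Lemma symmetric_rel_lspan (P : set (H * H)) :
  symmetric_rel P -> symmetric_rel (lspan P).
Proof.
have fst_sum n (a : 'I_n -> R[i]) (u : 'I_n -> H * H) :
    (\sum_(i < n) a i *: u i).1 = \sum_(i < n) a i *: (u i).1.
  by rewrite (big_morph (@fst H H) (id1 := 0) (op1 := +%R)).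
have snd_sum n (a : 'I_n -> R[i]) (u : 'I_n -> H * H) :
    (\sum_(i < n) a i *: u i).2 = \sum_(i < n) a i *: (u i).2.
  by rewrite (big_morph (@snd H H) (id1 := 0) (op1 := +%R)).
move=> sP _ _ [m [a [u [Pu ->]]]] [n [b [v [Pv ->]]]].
rewrite !fst_sum !snd_sum !inner_suml; apply: eq_bigr => i _.
rewrite !inner_sumr; apply: eq_bigr => j _.
by rewrite !innerZl !innerZr sP.
Qed.

(* With [v_k = \sum_i a_i b(t^k x_i)], symmetry gives
   [0 <= |v_k - v_(k+2)|^2 = |v_k|^2 + |v_(k+2)|^2 - 2 |v_(k+1)|^2]: the bounded
   sequence [|v_k|^2] is convex, hence nonincreasing. *)
Lemma symmetric_rel_contraction (I : Type) (D : set I) (b : I -> H) (t : I -> I) :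
  (forall i, D i -> D (t i)) ->
  (forall i, D i -> exists M : R[i], forall k, `|b (iter k t i)| <= M) ->
  (forall i j, D i -> D j -> '[b i, b (t j)] = '[b (t i), b j]) ->
  forall p, lspan [set p | exists2 i, D i & p = (b i, b (t i))] p -> `|p.2| <= `|p.1|.
Proof.
move=> Dt bM bt p [n [a [u [Pu ->]]]].
have {Pu} /choice[x Pu] i : exists x, D x /\ u i = (b x, b (t x)).
  by have [x Dx ->] := Pu i; exists x.
pose v k := \sum_(i < n) a i *: b (iter k t (x i)).
have -> : (\sum_(i < n) a i *: u i).1 = v 0%N.
  rewrite (big_morph (@fst H H) (id1 := 0) (op1 := +%R))//.
  by apply: eq_bigr => i _; rewrite (Pu i).2.
have -> : (\sum_(i < n) a i *: u i).2 = v 1%N.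
  rewrite (big_morph (@snd H H) (id1 := 0) (op1 := +%R))//.
  by apply: eq_bigr => i _; rewrite (Pu i).2.
have Dx k i : D (iter k t (x i)).
  by elim: k => [|k IH]; [exact: (Pu i).1|exact: Dt].
have vv k l : '[v k, v l.+1] = '[v k.+1, v l].
  rewrite /v !inner_suml; apply: eq_bigr => i _.
  rewrite !inner_sumr; apply: eq_bigr => j _.
  by rewrite !innerZl !innerZr /= bt//; exact: Dx.
have /choice[M bxM] i : exists M : R[i], forall k, `|b (iter k t (x i))| <= M.
  exact/bM/(Dx 0%N).
pose N := \sum_(i < n) `|a i| * M i.
have vN k : `|v k| <= N.
  apply: le_trans (ler_norm_sum _ _ _) _; apply: ler_sum => i _.
  by rewrite normrZ ler_wpM2l.
have sq u' : '[u', u'] = (complex.Re '[u', u'])%:C.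
  by have [r _ ->] := ge0_complexE (inner_ge0 dotn u').
have N0 : 0 <= N := le_trans (normr_ge0 _) (vN 0%N).
suff : '[v 1%N, v 1%N] <= '[v 0%N, v 0%N] by rewrite -!dotn ler_pXn2r ?nnegrE.
rewrite [leLHS]sq [leRHS]sq lecR.
apply: (@bounded_convex_le _ (fun k => complex.Re '[v k, v k]) (complex.Re (N ^+ 2))).
  move=> k; rewrite -lecR mulr2n !rmorphD /= -!sq.
  have := inner_ge0 dotn (v k - v k.+2).
  rewrite innerBl !innerBr (vv k k.+1) -(vv k.+1 k) => h.
  rewrite -subr_ge0; apply: le_trans h _.
  by rewrite le_eqVlt; apply/orP; left; apply/eqP; ring.
move=> k; rewrite -lecR -sq -dotn.
have -> : (complex.Re (N ^+ 2))%:C = N ^+ 2.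
  by have [r _ ->] := ge0_complexE (exprn_ge0 2 N0).
by rewrite lerXn2r ?nnegrE.
Qed.

Lemma closure_fst (V : normedModType R[i]) (G : set (V * V)) u v :
  closure G (u, v) -> closure [set u | exists v, G (u, v)] u.
Proof.
move=> /closure_normP cG; apply/closure_normP => e e0.
have [[x y] Gxy] := cG e e0; rewrite prod_normE /= => h; exists x; first by exists y.
apply: le_lt_trans h; rewrite comparable_le_max ?lexx//.
by rewrite real_comparable ?normr_real.
Qed.

(** Along pairs of [G] whose first components converge, contractivity makes the second components
    Cauchy; with dense domain the closure is thus defined everywhere. For [(u, v)] in the adjoint
    there is then some [(u, w)] in the closure, and symmetry makes [v - w] orthogonal to a dense
    set. *)
Lemma self_adjoint_closure (G : set (H * H)) :
  linear_subspace G -> symmetric_rel G ->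
  (forall p, G p -> `|p.2| <= `|p.1|) ->
  closure [set u | exists v, G (u, v)] = setT ->
  self_adjoint dot (closure G).
Proof.
move=> sG symG ctrG denseG.
have sGc := linear_subspace_closure sG.
have symGc x y u v : closure G (x, y) -> closure G (u, v) -> '[x, v] = '[y, u].
  move=> Gxy; apply: (inner_closure2 dotn) => {}u {}v Guv.
  apply: esym; rewrite inner_conj [RHS]inner_conj; congr conjc.
  by apply: (inner_closure2 dotn) Gxy => {}x {}y Gxy; exact: (symG (u, v) (x, y)).
have dense_c : closure [set u | exists v, closure G (u, v)] = setT.
  rewrite -subTset -denseG; apply: closure_subset => u [v Guv].
  by exists v; exact: subset_closure.
split => //.
  move=> u v w Guv Guw; apply/eqP; rewrite -subr_eq0; apply/eqP.
  apply: (inner_dense_eq0 dotn dense_c) => x [y Gxy].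
  by rewrite innerBl -(symGc _ _ _ _ Guv Gxy) -(symGc _ _ _ _ Guw Gxy) subrr.
have total u : exists v, closure G (u, v).
  have /choice[x xu] (n : nat) : exists p, G p /\ `|u - p.1| < (n.+1%:R)^-1.
    have /closure_normP/(_ n.+1%:R^-1) : closure [set u | exists v, G (u, v)] u by rewrite denseG.
    by rewrite invr_gt0 ltr0Sn => /(_ isT)[x [y Gxy] ?]; exists (x, y).
  have cauchy_norm m n : `|(x m).2 - (x n).2| <= `|(x m).1 - (x n).1|.
    rewrite -[_ - (x n).2]/((x m - x n).2) -[_ - (x n).1]/((x m - x n).1).
    by apply: ctrG; apply: (linear_subspaceB sG); exact: (xu _).1.
  have near_inv (e : R[i]) : 0 < e -> exists N, forall n, (N <= n)%N -> n.+1%:R^-1 < e.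
    move=> /gt0_complexE[r r0 ->]; exists (Num.bound r^-1) => n Nn.
    have -> : n.+1%:R = (n.+1%:R : R)%:C by rewrite rmorph_nat.
    rewrite -fmorphV ltcR invf_plt ?posrE//.
    apply: lt_le_trans (archi_boundP _) _; first by rewrite invr_ge0 ltW.
    by rewrite ler_nat (leq_trans Nn).
  have : cvg ((x n).2 @[n --> \oo]).
    apply: cauchy_cvg; apply/cauchy_ballP => e e0; near_simpl.
    have [N Nn] := near_inv (e / 2) (divr_gt0 e0 (ltr0Sn _ _)).
    exists ([set n | (N <= n)%N], [set n | (N <= n)%N]).
      by split; exists N.
    move=> [m n] [/= Nm Nn']; rewrite -ball_normE /=.
    apply: le_lt_trans (cauchy_norm m n) _.
    rewrite -(subrKA u) (splitr e) (le_lt_trans (ler_normD _ _))//.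
    rewrite distrC ltrD// (lt_trans (xu _).2)//; exact: Nn.
  move=> /cvg_ex[v /cvgrPdist_lt cv]; exists v; apply/closure_normP => e e0.
  have [N Nn] := near_inv e e0; have [N' _ N'n] := cv e e0.
  exists (x (maxn N N')); first exact: (xu _).1.
  rewrite prod_normE /= comparable_gt_max ?real_comparable ?normr_real//.
  apply/andP; split; last by apply: N'n; exact: leq_maxr.
  by apply: lt_trans (xu _).2 _; apply: Nn; exact: leq_maxl.
apply/seteqP; split=> [[u v]|[u v] Guv]; last first.
  by move=> x y Gxy; rewrite /=; exact: symGc Guv Gxy.
move=> /= adj; have [w Guw] := total u.
suff -> : v = w by [].
apply/eqP; rewrite -subr_eq0; apply/eqP.
apply: (inner_dense_eq0 dotn dense_c) => x [y Gxy].
by rewrite innerBl -(adj _ _ Gxy) -(symGc _ _ _ _ Guw Gxy) subrr.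
Qed.

End bounded_symmetric_relation.

(** * Complex-valued measurable functions *)

Section square_modulus.
Context {R : realType}.
Local Open Scope complex_scope.
Implicit Types z w : R[i].

(** The norm of [R[i]] takes values in [R[i]]. A squared modulus in [R] can be integrated and
    compared directly, and needs no square root. *)
Definition sqn z : R := complex.Re z ^+ 2 + complex.Im z ^+ 2.

Lemma sqn_ge0 z : 0 <= sqn z. Proof. by rewrite addr_ge0 ?sqr_ge0. Qed.

Lemma conjM_sqn z : conjc z * z = (sqn z)%:C.
Proof. by case: z => a b; rewrite /sqn /=; simpc; congr (_ +i* _); ring. Qed.

Lemma sqnM z w : sqn (z * w) = sqn z * sqn w.
Proof. by case: z w => [a b] [c e]; rewrite /sqn /=; ring. Qed.

Lemma sqn_conj z : sqn (conjc z) = sqn z.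
Proof. by case: z => a b; rewrite /sqn /= sqrrN. Qed.

Lemma sqnX z n : sqn (z ^+ n) = sqn z ^+ n.
Proof.
elim: n => [|n IH]; first by rewrite !expr0 /sqn /= expr1n expr0n addr0.
by rewrite !exprS sqnM IH.
Qed.

Lemma sqn_real (r : R) : sqn r%:C = r ^+ 2.
Proof. by rewrite /sqn /= expr0n addr0. Qed.

Lemma sqn_eq0 z : (sqn z == 0) = (z == 0).
Proof. by rewrite paddr_eq0 ?sqr_ge0// !sqrf_eq0 eq_complex. Qed.

Lemma sqn0 : sqn 0 = 0. Proof. by apply/eqP; rewrite sqn_eq0. Qed.

Lemma sqn1 : sqn 1 = 1. Proof. by rewrite /sqn /= expr1n expr0n addr0. Qed.

Lemma sqnV z : sqn z^-1 = (sqn z)^-1.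
Proof.
have [->|z0] := eqVneq z 0; first by rewrite invr0 sqn0 invr0.
by apply: (@mulfI _ (sqn z)); rewrite ?sqn_eq0// -sqnM !mulfV ?sqn_eq0// sqn1.
Qed.

Lemma sqnD_le z w : sqn (z + w) <= 2 * (sqn z + sqn w).
Proof.
case: z w => [a b] [c e]; rewrite /sqn /=.
have := sqr_ge0 (a - c); have := sqr_ge0 (b - e); nra.
Qed.

Lemma sqn_normc z : sqn z = Normc.normc z ^+ 2.
Proof. by case: z => a b; rewrite /= sqr_sqrtr// addr_ge0 ?sqr_ge0. Qed.

Lemma normc_ge0 z : 0 <= Normc.normc z.
Proof. by case: z => a b; exact: sqrtr_ge0. Qed.

Lemma Re_conjM_le z w : `|complex.Re (conjc z * w)| <= sqn z + sqn w.
Proof.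
case: z w => [a b] [c e]; rewrite /sqn /= ler_norml.
have := sqr_ge0 (a - c); have := sqr_ge0 (b - e).
have := sqr_ge0 (a + c); have := sqr_ge0 (b + e).
have := sqr_ge0 a; have := sqr_ge0 b; have := sqr_ge0 c; have := sqr_ge0 e.
by move=> *; apply/andP; split; nra.
Qed.

Lemma Im_conjM_le z w : `|complex.Im (conjc z * w)| <= sqn z + sqn w.
Proof.
case: z w => [a b] [c e]; rewrite /sqn /= ler_norml.
have := sqr_ge0 (a - e); have := sqr_ge0 (b - c).
have := sqr_ge0 (a + e); have := sqr_ge0 (b + c).
have := sqr_ge0 a; have := sqr_ge0 b; have := sqr_ge0 c; have := sqr_ge0 e.
by move=> *; apply/andP; split; nra.
Qed.

End square_modulus.

Section complex_functions.
Context {R : realType} {d : nat}.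
Local Open Scope complex_scope.
Local Notation C := R[i].
Local Notation X := (euclidean R d).
Local Notation mu := (lebesgue_euclidean R d).
Implicit Types f g k : X -> C.

Lemma aeqP (U : Type) (f g : X -> U) : (f = g %[ae mu]) <-> {ae mu, forall x, f x = g x}.
Proof. by split; apply: filterS => x; [exact|move=> + _]. Qed.

Lemma measurable_cfun_cst (a : C) : measurable_cfun (fun _ : X => a).
Proof. by split; exact: measurable_cst. Qed.

Lemma measurable_cfun_real (r : X -> R) :
  measurable_fun setT r -> measurable_cfun (fun x => (r x)%:C).
Proof. by move=> mr; split => //=; exact: measurable_cst. Qed.

Lemma measurable_cfunD f g :
  measurable_cfun f -> measurable_cfun g -> measurable_cfun (fun x => f x + g x).
Proof.
move=> [f1 f2] [g1 g2]; split.
  apply: eq_measurable_fun (measurable_funD f1 g1) => x _ /=.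
  by case: (f x) (g x) => [? ?] [].
apply: eq_measurable_fun (measurable_funD f2 g2) => x _ /=.
by case: (f x) (g x) => [? ?] [].
Qed.

Lemma measurable_cfunM f g :
  measurable_cfun f -> measurable_cfun g -> measurable_cfun (fun x => f x * g x).
Proof.
move=> [f1 f2] [g1 g2]; split.
  apply: eq_measurable_fun (measurable_funB (measurable_funM f1 g1) (measurable_funM f2 g2)).
  by move=> x _ /=; case: (f x) (g x) => [? ?] [].
apply: eq_measurable_fun (measurable_funD (measurable_funM f1 g2) (measurable_funM f2 g1)).
by move=> x _ /=; case: (f x) (g x) => [? ?] [].
Qed.

Lemma measurable_cfun_conj f :
  measurable_cfun f -> measurable_cfun (fun x => conjc (f x)).
Proof.
move=> [f1 f2]; split.
  by apply: eq_measurable_fun f1 => x _ /=; case: (f x).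
apply: eq_measurable_fun (measurable_funN f2) => x _ /=.
by case: (f x).
Qed.

Lemma measurable_cfunZ (a : C) f :
  measurable_cfun f -> measurable_cfun (fun x => a * f x).
Proof. by apply: measurable_cfunM; exact: measurable_cfun_cst. Qed.

Lemma measurable_cfunB f g :
  measurable_cfun f -> measurable_cfun g -> measurable_cfun (fun x => f x - g x).
Proof.
move=> mf mg; under eq_fun do rewrite -mulN1r.
by apply: measurable_cfunD => //; exact: measurable_cfunZ.
Qed.

Lemma measurable_cfunX n f :
  measurable_cfun f -> measurable_cfun (fun x => f x ^+ n).
Proof.
move=> mf; elim: n => [|n IH]; first exact: measurable_cfun_cst.
by under eq_fun do rewrite exprS; exact: measurable_cfunM.
Qed.

Lemma measurable_cfun_comp f (phi : X -> X) :
  measurable_fun setT phi -> measurable_cfun f -> measurable_cfun (fun x => f (phi x)).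
Proof.
by move=> mphi [f1 f2]; split; [exact: (measurableT_comp f1)|exact: (measurableT_comp f2)].
Qed.

Lemma measurable_sqn f : measurable_cfun f -> measurable_fun setT (fun x => sqn (f x)).
Proof. by move=> [f1 f2]; apply: measurable_funD; exact: measurable_funX. Qed.

Lemma measurable_cfunV f : measurable_cfun f -> measurable_cfun (fun x => (f x)^-1).
Proof.
move=> mf; have E x : (f x)^-1 = conjc (f x) * ((sqn (f x))^-1)%:C.
  have [->|f0] := eqVneq (f x) 0; first by rewrite sqn0 !invr0 conjc0 mul0r.
  rewrite fmorphV /= -conjM_sqn invfM mulrA mulfV ?mul1r// fmorph_eq0//.
under eq_fun do rewrite E.
apply: measurable_cfunM; first exact: measurable_cfun_conj.
apply: measurable_cfun_real.
(* On nonnegative reals the inverse, with value 0 at 0, is the real power of exponent -1, whose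
   measurability is available. *)
under eq_fun do rewrite -powR_inv1 ?sqn_ge0//.
exact: measurableT_comp (measurable_powR _) (measurable_sqn mf).
Qed.

Lemma measurable_indicC (A : set X) : measurable A -> measurable_cfun (\1_A : X -> C).
Proof.
move=> mA; have -> : (\1_A : X -> C) = (fun x => (\1_A x)%:C).
  by apply/funext => x; rewrite !indicE; case: (_ \in _).
exact/measurable_cfun_real/measurable_indic.
Qed.

Lemma measurable_cfun_eq f g :
  measurable_cfun f -> measurable_cfun g -> measurable [set x | f x = g x].
Proof.
move=> mf mg; have -> : [set x | f x = g x] = (fun x => sqn (f x - g x)) @^-1` [set 0].
  apply/seteqP; split=> x /=; first by move=> ->; rewrite subrr sqn0.
  by move=> /eqP; rewrite sqn_eq0 subr_eq0 => /eqP.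
rewrite -[X in measurable X]setTI.
by apply: (measurable_sqn (measurable_cfunB mf mg)) => //; exact: measurable_set1.
Qed.

(** A quantitative form of [L2Linf]: the estimates below are uniform over all [f] with the same [q]
    and [Q]. *)
Definition sq_bounded (q Q : R) f := [/\ measurable_cfun f,
  {ae mu, forall x, sqn (f x) <= q} & (\int[mu]_x (sqn (f x))%:E <= Q%:E)%E].

Lemma cnorm2_sqr f : (cnorm 2%:E f `^ 2 = \int[mu]_x (sqn (f x))%:E)%E.
Proof.
rewrite /cnorm poweR_Lnorm//; apply: eq_integral => x _.
by rewrite abse_EFin ger0_norm ?normc_ge0// poweR_EFin powR_mulrn ?normc_ge0// -sqn_normc.
Qed.

Lemma cnormy_leP f (M : R) : 0 <= M ->
  (cnorm +oo%E f <= M%:E)%E <-> {ae mu, forall x, sqn (f x) <= M ^+ 2}.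
Proof.
move=> M0.
have E x : (sqn (f x) <= M ^+ 2) = (abse (Normc.normc (f x))%:E <= M%:E)%E.
  by rewrite sqn_normc abse_EFin ger0_norm ?normc_ge0// lee_fin ler_pXn2r ?nnegrE ?normc_ge0.
rewrite /cnorm unlock; case: ifPn => [mu0|].
  split=> [/ess_supP|h]; first by apply: filterS => x /=; rewrite E.
  by apply/ess_supP; apply: filterS h => x; rewrite E.
(* If the whole space is null, the sup norm is 0 by convention and the a.e. bound is vacuous. *)
rewrite -leNgt lee_fin => mu0; split=> // _.
exists setT; split => //; apply/eqP; rewrite eq_le mu0/= measure_ge0//.
Qed.

Lemma L2LinfP f : L2Linf f <-> exists q Q, sq_bounded q Q f.
Proof.
split=> [[mf f2 foo]|[q [Q [mf fq fQ]]]].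
  have [M M0 fM] : exists2 M : R, 0 <= M & (cnorm +oo%E f <= M%:E)%E.
    have n0 : (0 <= cnorm +oo%E f)%E by exact: Lnorm_ge0.
    by exists (fine (cnorm +oo%E f)); rewrite ?fine_ge0// fineK// ge0_fin_numE.
  exists (M ^+ 2), (fine (\int[mu]_x (sqn (f x))%:E)); split => //.
    exact/cnormy_leP.
  rewrite fineK// ge0_fin_numE; last by apply: integral_ge0 => x _; rewrite lee_fin sqn_ge0.
  by rewrite -cnorm2_sqr poweR_lty.
split => //.
  rewrite ltNge leye_eq; apply/negP => /eqP foo.
  have := cnorm2_sqr f; rewrite foo poweRyr ?pnatr_eq0// => E.
  by move: fQ; rewrite -E leye_eq.
apply: (@le_lt_trans _ _ (1 + `|q|)%:E); last exact: ltry.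
apply/cnormy_leP; first by rewrite addr_ge0.
apply: filterS fq => x /le_trans; apply.
have := ler_norm q; have := normr_ge0 q; nra.
Qed.

End complex_functions.

(** * The algebra of square integrable bounded functions and its sesquilinear form *)

Section L2Linf_algebra.
Context {R : realType} {d : nat}.
Local Open Scope complex_scope.
Local Notation C := R[i].
Local Notation X := (euclidean R d).
Local Notation mu := (lebesgue_euclidean R d).
Implicit Types f g k : X -> C.

Let conjcB (a b : C) : conjc (a - b) = conjc a - conjc b. Proof. exact: rmorphB. Qed.
Let conjcM (a b : C) : conjc (a * b) = conjc a * conjc b. Proof. exact: rmorphM. Qed.

Lemma L2Linf_measurable f : L2Linf f -> measurable_cfun f. Proof. by case. Qed.

Lemma sq_bounded_L2Linf q Q f : sq_bounded q Q f -> L2Linf f.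
Proof. by move=> fq; apply/L2LinfP; exists q, Q. Qed.

Lemma L2Linf_bounded f : L2Linf f -> exists q : R, {ae mu, forall x, sqn (f x) <= q}.
Proof. by move=> /L2LinfP[q [Q []]]; exists q. Qed.

Lemma L2Linf_sqn f : L2Linf f -> mu.-integrable setT (EFin \o (fun x => sqn (f x))).
Proof.
move=> /L2LinfP[q [Q [mf _ fQ]]]; apply/integrableP; split.
  by apply/measurable_EFinP; exact: measurable_sqn.
under eq_integral do rewrite abse_EFin ger0_norm ?sqn_ge0//.
by rewrite (le_lt_trans fQ)// ltry.
Qed.

Lemma L2Linf_intro f q : measurable_cfun f -> {ae mu, forall x, sqn (f x) <= q} ->
  (\int[mu]_x (sqn (f x))%:E < +oo)%E -> L2Linf f.
Proof.
move=> mf fq foo; apply/L2LinfP; exists q, (fine (\int[mu]_x (sqn (f x))%:E)).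
split => //; rewrite fineK// ge0_fin_numE//.
by apply: integral_ge0 => x _; rewrite lee_fin sqn_ge0.
Qed.

Lemma L2LinfD f g : L2Linf f -> L2Linf g -> L2Linf (fun x => f x + g x).
Proof.
move=> Lf Lg; have [mf mg] := (L2Linf_measurable Lf, L2Linf_measurable Lg).
have [[q fq] [r gr]] := (L2Linf_bounded Lf, L2Linf_bounded Lg).
apply: (@L2Linf_intro _ (2 * (q + r))); first exact: measurable_cfunD.
  apply: filterS2 fq gr => x fx gx; apply: le_trans (sqnD_le _ _) _.
  by rewrite ler_wpM2l// lerD.
apply: (@le_lt_trans _ _ (\int[mu]_x (2%:E * ((sqn (f x))%:E + (sqn (g x))%:E)))%E).
  apply: ge0_le_integral => //.
  - by move=> x _; rewrite lee_fin sqn_ge0.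
  - by apply/measurable_EFinP; apply: measurable_sqn; exact: measurable_cfunD.
  - apply/measurable_EFinP; apply: measurable_funM; first exact: measurable_cst.
    by apply: measurable_funD; exact: measurable_sqn.
  - by move=> x _; rewrite -EFinD -EFinM lee_fin sqnD_le.
apply: integrable_lty => //; apply: integrableZl => //.
by apply: integrableD => //; exact: L2Linf_sqn.
Qed.

Lemma L2LinfM_bounded (b f : X -> C) q : measurable_cfun b ->
  {ae mu, forall x, sqn (b x) <= q} -> L2Linf f -> L2Linf (fun x => b x * f x).
Proof.
move=> mb bq Lf; have mf := L2Linf_measurable Lf.
have [r fr] := L2Linf_bounded Lf.
apply: (@L2Linf_intro _ (q * r)); first exact: measurable_cfunM.
  by apply: filterS2 bq fr => x bx fx; rewrite sqnM ler_pM ?sqn_ge0.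
have sq := L2Linf_sqn Lf.
apply: (@le_lt_trans _ _ (\int[mu]_x (`|q|%:E * (sqn (f x))%:E))%E); last first.
  by apply: integrable_lty => //; exact: integrableZl.
apply: ae_ge0_le_integral => //.
- by move=> x _; rewrite lee_fin sqn_ge0.
- by apply/measurable_EFinP; apply: measurable_sqn; exact: measurable_cfunM.
- by move=> x _; rewrite -EFinM lee_fin mulr_ge0// sqn_ge0.
- apply/measurable_EFinP; apply: measurable_funM; first exact: measurable_cst.
  exact: measurable_sqn.
apply: filterS bq => x bx _; rewrite -EFinM lee_fin sqnM ler_wpM2r ?sqn_ge0//.
by rewrite (le_trans bx)// ler_norm.
Qed.

Lemma L2LinfZ (a : C) f : L2Linf f -> L2Linf (fun x => a * f x).
Proof.
by apply: (@L2LinfM_bounded _ _ (sqn a)); [exact: measurable_cfun_cst|exact: aeW].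
Qed.

Lemma L2LinfB f g : L2Linf f -> L2Linf g -> L2Linf (fun x => f x - g x).
Proof.
move=> Lf Lg; under eq_fun do rewrite -mulN1r.
by apply: L2LinfD => //; exact: L2LinfZ.
Qed.

Lemma L2LinfM f g : L2Linf f -> L2Linf g -> L2Linf (fun x => f x * g x).
Proof.
by move=> Lf; have [q fq] := L2Linf_bounded Lf; exact: (L2LinfM_bounded (L2Linf_measurable Lf) fq).
Qed.

Lemma L2LinfX n f : L2Linf f -> L2Linf (fun x => f x ^+ n.+1).
Proof.
move=> Lf; elim: n => [|n IH]; first by under eq_fun do rewrite expr1.
by under eq_fun do rewrite exprS; exact: L2LinfM.
Qed.

Lemma L2Linf_indicM (A : set X) f : measurable A -> L2Linf f -> L2Linf (fun x => \1_A x * f x).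
Proof.
move=> mA; apply: (@L2LinfM_bounded _ _ 1); first exact: measurable_indicC.
by apply: aeW => x; rewrite indicE; case: (_ \in _); rewrite ?sqn1 ?sqn0.
Qed.

Definition cintegrable f :=
  mu.-integrable setT (EFin \o (fun x => complex.Re (f x))) /\
  mu.-integrable setT (EFin \o (fun x => complex.Im (f x))).

Lemma cintegrable_conjM f g : L2Linf f -> L2Linf g ->
  cintegrable (fun x => conjc (f x) * g x).
Proof.
move=> Lf Lg; have [mf mg] := (L2Linf_measurable Lf, L2Linf_measurable Lg).
have [m1 m2] := measurable_cfunM (measurable_cfun_conj mf) mg.
have ifg := integrableD measurableT (L2Linf_sqn Lf) (L2Linf_sqn Lg).
split; (apply: le_integrable ifg => //; first exact/measurable_EFinP).
  move=> x _; rewrite /= lee_fin (le_trans (Re_conjM_le _ _))// ler_norm//.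
by move=> x _; rewrite /= lee_fin (le_trans (Im_conjM_le _ _))// ler_norm.
Qed.

Lemma eq_cintegral f g : measurable_cfun f -> measurable_cfun g ->
  {ae mu, forall x, f x = g x} -> cintegral f = cintegral g.
Proof.
move=> [f1 f2] [g1 g2] fg; rewrite /cintegral /Rintegral; congr (Complex (fine _) (fine _)).
  by apply: ae_eq_integral => //; [exact/measurable_EFinP..|apply: filterS fg => x -> _].
by apply: ae_eq_integral => //; [exact/measurable_EFinP..|apply: filterS fg => x -> _].
Qed.

Lemma cintegralD f g : cintegrable f -> cintegrable g ->
  cintegral (fun x => f x + g x) = cintegral f + cintegral g.
Proof.
move=> [f1 f2] [g1 g2]; rewrite /cintegral [RHS]/GRing.add /=.
rewrite -!RintegralD//; congr Complex; apply: eq_Rintegral => x _;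
  by case: (f x) (g x) => [? ?] [].
Qed.

Lemma cintegralZ (a : C) f : cintegrable f ->
  cintegral (fun x => a * f x) = a * cintegral f.
Proof.
case: a => a b [f1 f2]; rewrite /cintegral [RHS]/GRing.mul /=.
have Zl (r : R) (h : X -> R) : mu.-integrable setT (EFin \o h) ->
    mu.-integrable setT (EFin \o (fun x => r * h x)).
  by move=> ih; exact: (integrableZl measurableT r ih).
rewrite -!RintegralZl// -RintegralB//; [|exact: Zl..].
rewrite -RintegralD//; [|exact: Zl..].
by congr Complex; apply: eq_Rintegral => x _; case: (f x).
Qed.

Lemma L2innerDr f g1 g2 : L2Linf f -> L2Linf g1 -> L2Linf g2 ->
  L2inner f (fun x => g1 x + g2 x) = L2inner f g1 + L2inner f g2.
Proof.
move=> Lf L1 L2; rewrite /L2inner -cintegralD; [|exact: cintegrable_conjM..].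
by congr cintegral; apply/funext => x; rewrite mulrDr.
Qed.

Lemma L2innerZr (a : C) f g : L2Linf f -> L2Linf g ->
  L2inner f (fun x => a * g x) = a * L2inner f g.
Proof.
move=> Lf Lg; rewrite /L2inner -cintegralZ; last exact: cintegrable_conjM.
by congr cintegral; apply/funext => x; rewrite mulrCA.
Qed.

Lemma L2innerBr f g1 g2 : L2Linf f -> L2Linf g1 -> L2Linf g2 ->
  L2inner f (fun x => g1 x - g2 x) = L2inner f g1 - L2inner f g2.
Proof.
move=> Lf L1 L2; under eq_fun do rewrite -mulN1r.
rewrite L2innerDr//; last exact: L2LinfZ.
by rewrite L2innerZr// mulN1r.
Qed.

Lemma L2inner_conj f g : L2Linf f -> L2Linf g -> L2inner g f = conjc (L2inner f g).
Proof.
move=> Lf Lg; have [i1 i2] := cintegrable_conjM Lf Lg.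
rewrite /L2inner /cintegral /=; congr Complex.
  by apply: eq_Rintegral => x _; case: (f x) (g x) => [? ?] [? ?] /=; ring.
rewrite -mulN1r -RintegralZl//; apply: eq_Rintegral => x _.
by case: (f x) (g x) => [? ?] [? ?] /=; ring.
Qed.

Lemma L2innerZl (a : C) f g : L2Linf f -> L2Linf g ->
  L2inner (fun x => a * f x) g = conjc a * L2inner f g.
Proof.
move=> Lf Lg; rewrite L2inner_conj ?L2innerZr//; last exact: L2LinfZ.
by rewrite conjcM -L2inner_conj.
Qed.

Lemma L2innerBl f1 f2 g : L2Linf f1 -> L2Linf f2 -> L2Linf g ->
  L2inner (fun x => f1 x - f2 x) g = L2inner f1 g - L2inner f2 g.
Proof.
move=> L1 L2 Lg; rewrite L2inner_conj ?L2innerBr//; last exact: L2LinfB.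
by rewrite conjcB -!L2inner_conj.
Qed.

Lemma eq_L2inner f f' g g' : L2Linf f -> L2Linf f' -> L2Linf g -> L2Linf g' ->
  {ae mu, forall x, f x = f' x} -> {ae mu, forall x, g x = g' x} ->
  L2inner f g = L2inner f' g'.
Proof.
move=> Lf Lf' Lg Lg' ff' gg'; apply: eq_cintegral.
- by apply: measurable_cfunM; [apply: measurable_cfun_conj|]; exact: L2Linf_measurable.
- by apply: measurable_cfunM; [apply: measurable_cfun_conj|]; exact: L2Linf_measurable.
by apply: filterS2 ff' gg' => x -> ->.
Qed.

Lemma L2inner_sqn f : L2inner f f = (\int[mu]_x sqn (f x))%:C.
Proof.
rewrite /L2inner /cintegral /=; under [X in Complex X _]eq_Rintegral do rewrite conjM_sqn.
under [X in Complex _ X]eq_Rintegral do rewrite conjM_sqn.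
congr Complex; rewrite /= /Rintegral integral0_eq//.
Qed.

(** The integrand is [w * |k|^2], so testing [k] against [w * k] detects it as well as testing
    against [k] does. In the applications [w * k] is a product of two elements of the space, the
    shape required by identities that concern products. *)
Lemma L2inner_weight_eq0 k (w : X -> R) : measurable_fun setT w -> (forall x, 0 < w x) ->
  L2Linf k -> L2Linf (fun x => (w x)%:C * k x) ->
  L2inner k (fun x => (w x)%:C * k x) = 0 -> {ae mu, forall x, k x = 0}.
Proof.
move=> mw w0 Lk Lwk.
have [i1 _] := cintegrable_conjM Lk Lwk.
have E : (fun x => complex.Re (conjc (k x) * ((w x)%:C * k x))) = (fun x => w x * sqn (k x)).
  by apply/funext => x; rewrite mulrCA conjM_sqn -rmorphM.
rewrite /L2inner /cintegral E => -[/eqP + _]; rewrite E in i1.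
rewrite /Rintegral fine_eq0 ?integrable_fin_num// => /eqP int0.
have : (\int[mu]_x `|(w x * sqn (k x))%:E| = 0)%E.
  rewrite -[RHS]int0; apply: eq_integral => x _.
  by rewrite abse_EFin ger0_norm// mulr_ge0 ?sqn_ge0// ltW.
move/ae_eq_integral_abs => /(_ measurableT); case.
  by case/integrableP : i1.
move=> N [mN N0 sN]; exists N; split => //.
apply: subset_trans sN => x /= + /(_ Logic.I)[] /eqP; rewrite mulf_eq0 gt_eqF//= sqn_eq0.
by move=> + /eqP.
Qed.

Lemma L2inner_eq0 k : L2Linf k -> L2inner k k = 0 -> {ae mu, forall x, k x = 0}.
Proof.
move=> Lk k0; apply: (@L2inner_weight_eq0 _ (fun=> 1)) => //.
  by apply: L2LinfZ.
by under [X in L2inner _ X]eq_fun do rewrite mul1r.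
Qed.

Lemma L2inner_sq_bounded q Q f n : 0 <= q -> sq_bounded q Q f ->
  complex.Re (L2inner (fun x => f x ^+ n.+1) (fun x => f x ^+ n.+1)) <= q ^+ n * Q.
Proof.
move=> q0 fb; have Lf := sq_bounded_L2Linf fb; have [mf fq fQ] := fb.
rewrite L2inner_sqn /= -lee_fin /Rintegral fineK; last first.
  by apply: integrable_fin_num => //; exact/L2Linf_sqn/L2LinfX.
apply: (@le_trans _ _ (\int[mu]_x ((q ^+ n)%:E * (sqn (f x))%:E))%E).
  apply: ae_ge0_le_integral => //.
  - by move=> x _; rewrite lee_fin sqn_ge0.
  - by apply/measurable_EFinP; apply: measurable_sqn; exact: measurable_cfunX.
  - by move=> x _; rewrite -EFinM lee_fin mulr_ge0// ?exprn_ge0 ?sqn_ge0.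
  - apply/measurable_EFinP; apply: measurable_funM; first exact: measurable_cst.
    exact: measurable_sqn.
  apply: filterS fq => x fx _; rewrite -EFinM lee_fin sqnX exprSr.
  by rewrite ler_wpM2r ?sqn_ge0// lerXn2r// nnegrE// sqn_ge0.
rewrite ge0_integralZl//; last 3 first.
- by apply/measurable_EFinP; exact: measurable_sqn.
- by move=> x _; rewrite lee_fin sqn_ge0.
- by rewrite lee_fin exprn_ge0.
by rewrite EFinM lee_wpmul2l// lee_fin exprn_ge0.
Qed.

End L2Linf_algebra.

(** * Growth of the number vectors and convergence of the exponential vectors *)

Section majorant.
Context {R : realType}.

(* [b n = \sum_k rho^k a_(n-k)] satisfies [b (n+1) <= (C / (n+1) + rho) b n]. *)
Lemma renewal_geometric (C rho r : R) : 0 <= C -> 0 <= rho -> rho < r ->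
  exists2 K : R, 0 <= K & forall a : nat -> R,
    (forall n, 0 <= a n) -> a 0%N = 1 ->
    (forall n, n.+1%:R * a n.+1 <= C * \sum_(k < n.+1) rho ^+ k * a (n - k)%N) ->
    forall n, a n <= K * r ^+ n.
Proof.
move=> C0 rho0 rhor; have r0 : 0 < r := le_lt_trans rho0 rhor.
(* [p] solves the recursion with equality and so dominates [b]; only finitely many of its factors
   can exceed [r]. *)
pose p n := \prod_(i < n) (C / i.+1%:R + rho).
have p0 n : 0 <= p n by apply: prodr_ge0 => i _; rewrite addr_ge0// divr_ge0.
have [N CN] : exists N : nat, forall n, (N <= n)%N -> C / n.+1%:R + rho <= r.
  exists (Num.bound (C / (r - rho))) => n Nn; rewrite -lerBrDr ler_pdivrMr// mulrC.
  rewrite -ler_pdivrMr ?subr_gt0//; apply: le_trans (ltW (archi_boundP _)) _.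
    by rewrite divr_ge0// subr_ge0 ltW.
  by rewrite ler_nat (leq_trans Nn).
(* This sum dominates each [p i / r ^+ i] with [i <= N]; beyond [N] every further factor of [p] is
   at most [r]. It does not involve the sequence [a]. *)
pose K := \sum_(i < N.+1) p i / r ^+ i.
have K0 : 0 <= K by apply: sumr_ge0 => i _; rewrite divr_ge0// exprn_ge0// ltW.
have pK n : p n <= K * r ^+ n.
  have [nN|Nn] := leqP n N.
    rewrite -ler_pdivrMr ?exprn_gt0// /K (bigD1 (Ordinal (nN : (n < N.+1)%N)))//= lerDl.
    by apply: sumr_ge0 => i _; rewrite divr_ge0// exprn_ge0// ltW.
  have := ltnW Nn; elim: n {Nn} => [|n IH].
    rewrite leqn0 => /eqP N0.
    rewrite -ler_pdivrMr ?exprn_gt0// /K (bigD1 ord0)//= lerDl.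
    by apply: sumr_ge0 => i _; rewrite divr_ge0// exprn_ge0// ltW.
  rewrite leq_eqVlt => /predU1P[Nn|Nn].
    rewrite -ler_pdivrMr ?exprn_gt0// /K Nn (bigD1 (@ord_max n.+1))//= lerDl.
    by apply: sumr_ge0 => i _; rewrite divr_ge0// exprn_ge0// ltW.
  rewrite /p big_ord_recr /= -/(p n) exprSr mulrA ler_pM//; last exact: CN.
    by rewrite addr_ge0// divr_ge0.
  exact: IH.
exists K => // a a0 a01 rec n; apply: le_trans (pK n).
pose b n := \sum_(k < n.+1) rho ^+ k * a (n - k)%N.
have ab m : a m <= b m.
  rewrite /b big_ord_recl expr0 mul1r subn0 lerDl.
  by apply: sumr_ge0 => i _; rewrite mulr_ge0// exprn_ge0.
apply: le_trans (ab n) _; elim: n => [|n IH].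
  by rewrite /b big_ord_recl big_ord0 expr0 mul1r addr0 subn0 a01 /p big_ord0.
have -> : b n.+1 = a n.+1 + rho * b n.
  rewrite /b big_ord_recl expr0 mul1r subn0; congr (_ + _).
  by rewrite mulr_sumr; apply: eq_bigr => i _; rewrite exprS mulrA subSS.
rewrite /p big_ord_recr /= -/(p n) [leRHS]mulrC.
apply: (@le_trans _ _ ((C / n.+1%:R + rho) * b n)); last first.
  by rewrite ler_wpM2l// addr_ge0// divr_ge0.
by rewrite mulrDl lerD2r mulrAC ler_pdivlMr// mulrC rec.
Qed.

End majorant.

Section normed_series.
Context {R : realType}.
Local Open Scope complex_scope.

Lemma geometric_cvg_series (V : completeNormedModType R[i]) (u : V^nat) (K r : R) :
  0 <= r -> r < 1 -> (forall n, `|u n| <= (K * r ^+ n)%:C) -> cvgn (series u).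
Proof.
move=> r0 r1 uK; apply: cauchy_cvg; apply/cauchy_seriesP => e /gt0_complexE[e' e'0 ->].
have : cvgn (series (geometric K r)) by apply: is_cvg_geometric_series; rewrite ger0_norm.
move=> /cvg_cauchy/cauchy_seriesP/(_ _ e'0); apply: filterS => -[m n] /= h.
apply: le_lt_trans (ler_norm_sum _ _ _) _.
apply: (@le_lt_trans _ _ (\sum_(m <= k < n) (K * r ^+ k)%:C)); first exact: ler_sum.
by rewrite -rmorph_sum /= ltcR (le_lt_trans _ h)// ler_norm.
Qed.

Lemma geometric_sum_le (u : nat -> R[i]) (K r : R) : 0 <= K -> 0 <= r -> r < 1 ->
  (forall n, u n <= (K * r ^+ n)%:C) -> forall n, \sum_(k < n) u k <= (K / (1 - r))%:C.
Proof.
move=> K0 r0 r1 uK n; apply: (@le_trans _ _ (\sum_(k < n) (K * r ^+ k)%:C)).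
  exact: ler_sum.
rewrite -rmorph_sum /= lecR -mulr_sumr ler_wpM2l// -[leRHS]mul1r ler_pdivlMr ?subr_gt0//.
by rewrite -[1 - r]opprB mulrN mulrC -subrX1 opprB gerBl exprn_ge0.
Qed.

End normed_series.

Section closures.
Context {K : numFieldType}.

Lemma cvg_mem_closure (V : normedModType K) (A : set V) (u : V^nat) (l : V) :
  (forall n, A (u n)) -> u n @[n --> \oo] --> l -> closure A l.
Proof.
move=> Au /cvgrPdist_lt ul; apply/closure_normP => e e0.
by have [N _ /(_ N (leqnn N)) h] := ul e e0; exists (u N).
Qed.

Lemma series_pair (V W : normedModType K) (u : V^nat) (v : W^nat) n :
  series (fun n => (u n, v n) : V * W) n = (series u n, series v n).
Proof.
rewrite !seriesEnat; rewrite [LHS]surjective_pairing; congr pair.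
  by rewrite (big_morph (@fst V W) (id1 := 0) (op1 := +%R)).
by rewrite (big_morph (@snd V W) (id1 := 0) (op1 := +%R)).
Qed.

Lemma scale_pair (V W : normedModType K) (a : K) (u : V) (v : W) :
  a *: ((u, v) : V * W) = (a *: u, a *: v).
Proof. by []. Qed.

Lemma norm_pair_le (V W : normedModType K) (u : V) (v : W) :
  `|(u, v) : V * W| <= `|u| + `|v|.
Proof.
rewrite prod_normE /= comparable_ge_max ?real_comparable ?normr_real//.
by rewrite lerDl lerDr !normr_ge0.
Qed.

End closures.

Section quadratic_fock_space.
Context {R : realType} {d : nat} (H : completeNormedModType R[i]).
Context (dot : {dot H for Num.conj}) (c : R) (c0 : 0 < c) (Phi : H).
Context (B : nat -> (euclidean R d -> R[i]) -> H).
Hypothesis hB : quadratic_fock dot c Phi B.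
Local Open Scope complex_scope.
Local Notation C := R[i].
Local Notation X := (euclidean R d).
Local Notation mu := (lebesgue_euclidean R d).
Local Notation "''[' u , v ]" := (inner dot u v).
Implicit Types f g : X -> C.

Let dotn := fock_inner_norm hB.

Lemma fock_inner0 f g : L2Linf f -> L2Linf g -> '[B 0 f, B 0 g] = 1.
Proof. by move=> Lf Lg; rewrite !(fock_vacuum hB)// -dotn (fock_vacuum_unit hB) expr1n. Qed.

Lemma fock_innerS_eq f g f' g' n : L2Linf f -> L2Linf g -> L2Linf f' -> L2Linf g' ->
  (forall k, L2inner (fun x => f x ^+ k.+1) (fun x => g x ^+ k.+1) =
             L2inner (fun x => f' x ^+ k.+1) (fun x => g' x ^+ k.+1)) ->
  '[B n f, B n g] = '[B n f', B n g'].
Proof.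
move=> Lf Lg Lf' Lg' h; elim/ltn_ind : n => -[|n] IH; first by rewrite !fock_inner0.
rewrite !(fock_inner hB)//; congr (_ * _); apply: eq_bigr => k _.
by rewrite h IH// subnAC subn1 ltnS leq_subr.
Qed.

(** Neither homogeneity of [B] nor its invariance under a.e. equality is assumed. Both follow from
    the inner products: by the recursion the difference is orthogonal to every [B n g], hence to
    itself. The case [a = 1] covers a change of representative. *)
Lemma fock_scale (a : C) f f' n : L2Linf f -> L2Linf f' ->
  {ae mu, forall x, f' x = a * f x} -> B n f' = a ^+ n *: B n f.
Proof.
move=> Lf Lf' ff'.
have key g : L2Linf g -> '[B n f' - a ^+ n *: B n f, B n g] = 0.
  move=> Lg; rewrite innerBl innerZl; apply/eqP; rewrite subr_eq0; apply/eqP.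
  elim/ltn_ind : n => -[|n] IH; first by rewrite !fock_inner0// expr0 conjc1 mul1r.
  rewrite !(fock_inner hB)// mulrCA; congr (_ * _); rewrite mulr_sumr.
  rewrite !big_mkord; apply: eq_bigr => k _.
  have kn : (n.+1 - k - 1)%N = (n - k)%N by rewrite subnAC subn1.
  rewrite kn IH; last by rewrite ltnS leq_subr.
  have -> : L2inner (fun x => f' x ^+ k.+1) (fun x => g x ^+ k.+1) =
      conjc (a ^+ k.+1) * L2inner (fun x => f x ^+ k.+1) (fun x => g x ^+ k.+1).
    rewrite -(L2innerZl _ (L2LinfX k Lf) (L2LinfX k Lg)).
    apply: eq_L2inner => //; try exact: L2LinfX.
    - exact/L2LinfZ/L2LinfX.
    - by apply: filterS ff' => x ->; rewrite exprMn.
    - exact: aeW.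
  have -> : a ^+ n.+1 = a ^+ k.+1 * a ^+ (n - k).
    by rewrite -exprD addSn subnKC// -ltnS.
  have cM (x y : C) : conjc (x * y) = conjc x * conjc y by exact: rmorphM.
  have E (D p z1 p' z2 : C) : D * (p * z1) * (p' * z2) = p * p' * (D * z1 * z2) by ring.
  by rewrite cM; exact: E.
apply/eqP; rewrite -subr_eq0; apply/eqP/(inner_eq0 dotn).
rewrite [X in '[_, X]](_ : _ = B n f' - a ^+ n *: B n f)//.
by rewrite innerBr innerZr !key// mulr0 subrr.
Qed.

(** For [a n = |B n f|^2 / n!^2] the recursion reads [(n+1) a_(n+1) = 2c \sum_k 4^k <f^(k+1),
    f^(k+1)> a_(n-k)], and the inner product is at most [q^k Q]. This is a renewal inequality with
    constant [2 c Q] and ratio [4 q]; the sup norm 1/2 is the threshold for a ratio below 1. *)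
Lemma fock_norm_le q Q r : 0 <= q -> 0 <= Q -> 0 < r -> 4 * q < r ^+ 2 ->
  exists2 K : R, 0 <= K & forall f, sq_bounded q Q f ->
    forall n, `|n`!%:R^-1 *: B n f| <= (K * r ^+ n)%:C.
Proof.
move=> q0 Q0 r0 qr.
have [K K0 KP] := @renewal_geometric R (2 * c * Q) (4 * q) (r ^+ 2)
  ltac:(by rewrite !mulr_ge0// ltW) ltac:(by rewrite mulr_ge0) qr.
have CM (x y : R) : (x * y)%:C = x%:C * y%:C by exact: rmorphM.
have CX (x : R) m : (x ^+ m)%:C = x%:C ^+ m by exact: rmorphXn.
have Cn m : (m%:R : R)%:C = m%:R by exact: rmorph_nat.
(* The estimate bounds the squared norm by [K * r ^+ (2 * n)], and [K <= (K + 1) ^+ 2] spares a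
   square root. *)
exists (K + 1); first by rewrite addr_ge0.
move=> f fb n; have Lf := sq_bounded_L2Linf fb.
pose a m := complex.Re '[B m f, B m f] / (m`!%:R ^+ 2).
have aE m : '[B m f, B m f] = (a m * m`!%:R ^+ 2)%:C.
  have [s _ E] := ge0_complexE (inner_ge0 dotn (B m f)).
  by rewrite /a E /= mulfVK// expf_neq0// pnatr_eq0 -lt0n fact_gt0.
have a0 m : 0 <= a m.
  have [s s0 E] := ge0_complexE (inner_ge0 dotn (B m f)).
  by rewrite /a E /= divr_ge0// exprn_ge0.
have a01 : a 0%N = 1 by rewrite /a fock_inner0// fact0 expr1n divr1.
have {KP} : a n <= K * (r ^+ 2) ^+ n.
  apply: KP => // m.
  pose s k := complex.Re (L2inner (fun x => f x ^+ k.+1) (fun x => f x ^+ k.+1)).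
  have sE k : L2inner (fun x => f x ^+ k.+1) (fun x => f x ^+ k.+1) = (s k)%:C.
    by rewrite /s L2inner_sqn.
  have s_le k : s k <= q ^+ k * Q by exact: L2inner_sq_bounded.
  have : a m.+1 * m.+1`!%:R ^+ 2 = c * \sum_(k < m.+1)
      (2 ^+ (2 * k + 1) * (m.+1`! * m`!)%:R * s k * a (m - k)%N).
    apply: complexI; rewrite -aE (fock_inner hB)// CM; congr (_ * _).
    rewrite (rmorph_sum (real_complex R)) /= big_mkord; apply: eq_bigr => k _.
    have -> : (m.+1 - k - 1)%N = (m - k)%N by rewrite subnAC subn1.
    rewrite sE aE subn1 /= !CM !CX !Cn natrX.
    have : (m - k)`!%:R != 0 :> C by rewrite pnatr_eq0 -lt0n fact_gt0.
    by move=> ?; field.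
  have -> : (m.+1`!%:R : R) ^+ 2 = (m.+1`! * m`!)%:R * m.+1%:R.
    by rewrite factS expr2 -!natrM; congr (_%:R); ring.
  move=> E.
  have fm0 : 0 < (m.+1`! * m`!)%:R :> R by rewrite ltr0n muln_gt0 !fact_gt0.
  rewrite -(ler_pM2l fm0) mulrA (mulrC _ (a m.+1)) E.
  rewrite !mulr_sumr; apply: ler_sum => k _.
  have -> : 2 ^+ (2 * k + 1) = 2 * 4 ^+ k :> R.
    by rewrite exprD expr1 mulrC exprM; congr (_ * _ ^+ _); rewrite expr2 -natrM.
  rewrite exprMn.
  have h := s_le k; set F := (m.+1`! * m`!)%:R in fm0 *.
  have am := a0 (m - k)%N.
  rewrite [leLHS](_ : _ = (c * 2 * 4 ^+ k * F * a (m - k)%N) * s k); last by ring.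
  rewrite [leRHS](_ : _ = (c * 2 * 4 ^+ k * F * a (m - k)%N) * (q ^+ k * Q)); last by ring.
  apply: ler_wpM2l h; have F0 := ltW fm0; have c0' := ltW c0.
  by do ![apply: mulr_ge0 => //]; rewrite exprn_ge0.
move=> an; have Kr0 : 0 <= (K + 1) * r ^+ n by rewrite mulr_ge0 ?addr_ge0// exprn_ge0// ltW.
rewrite -(@ler_pXn2r _ 2) ?nnegrE ?ler0c//.
have nz : (n`!%:R : C) != 0 by rewrite pnatr_eq0 -lt0n fact_gt0.
rewrite normrZ exprMn dotn aE CM CX Cn ger0_norm ?invr_ge0// exprVn mulrC mulfK ?expf_neq0//.
rewrite -CX lecR (le_trans an)//.
rewrite -exprM mulnC exprM (exprMn _ (K + 1)) ler_wpM2r ?sqr_ge0//.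
by have := K0; nra.
Qed.

End quadratic_fock_space.

(** * The closed graph described by number vectors *)

Section second_quantization_graph.
Context {R : realType} {d : nat} (H : completeNormedModType R[i]).
Context (dot : {dot H for Num.conj}) (c : R) (c0 : 0 < c) (Phi : H).
Context (B : nat -> (euclidean R d -> R[i]) -> H).
Hypothesis hB : quadratic_fock dot c Phi B.
Local Open Scope complex_scope.
Local Notation C := R[i].
Local Notation X := (euclidean R d).
Local Notation mu := (lebesgue_euclidean R d).
Local Notation "''[' u , v ]" := (inner dot u v).
Implicit Types f g : X -> C.

Lemma sq_bounded_small f : L2Linf f -> (cnorm +oo%E f < (2^-1)%:E)%E ->
  exists q Q r : R, [/\ 0 <= q /\ 0 <= Q, 0 < r /\ r < 1, 4 * q < r ^+ 2 & sq_bounded q Q f].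
Proof.
move=> Lf f2.
have n0 : (0 <= cnorm +oo%E f)%E by exact: Lnorm_ge0.
have foo : (cnorm +oo%E f = (fine (cnorm +oo%E f))%:E)%E.
  by rewrite fineK// ge0_fin_numE// (lt_trans f2)// ltry.
set M := fine _ in foo.
have M0 : 0 <= M by rewrite -lee_fin -foo.
have M2 : 2 * M < 1.
  by move: f2; rewrite foo lte_fin => f2; rewrite mulrC -ltr_pdivlMr// mul1r.
have fM : {ae mu, forall x, sqn (f x) <= M ^+ 2} by apply/cnormy_leP => //; rewrite foo.
have /L2LinfP[_ [Q [mf _ fQ]]] := Lf.
(* [r] is the midpoint of [2 * M] and 1, so that [4 * q = (2 * M) ^+ 2 < r ^+ 2] and [r < 1]. *)
exists (M ^+ 2), (Num.max 0 Q), ((1 + 2 * M) / 2); split => //.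
- by rewrite sqr_ge0 le_max lexx.
- by split; lra.
- have : 0 <= 2 * M by rewrite mulr_ge0.
  set m := 2 * M in M2 * => m0; have -> : 4 * M ^+ 2 = m ^+ 2 by rewrite /m; ring.
  by rewrite ltr_pXn2r ?nnegrE//; lra.
split => //; apply: le_trans fQ _; rewrite lee_fin le_max lexx orbT//.
Qed.

Lemma expvec_cvg f : L2Linf f -> (cnorm +oo%E f < (2^-1)%:E)%E ->
  series (fun n => n`!%:R^-1 *: B n f) n @[n --> \oo] --> expvec B f.
Proof.
move=> Lf f2; have [q [Q [r [[q0 Q0] [r0 r1] qr fb]]]] := sq_bounded_small Lf f2.
have [K K0 KP] := fock_norm_le c0 hB q0 Q0 r0 qr.
exact: (geometric_cvg_series (ltW r0) r1 (KP f fb)).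
Qed.

Context (T : (X -> C) -> (X -> C)).
Hypotheses (hT : L2Linf_operator T) (hTinf : Linf_contraction T).

Lemma operatorZ (a : C) f : L2Linf f ->
  {ae mu, forall x, T (fun x => a * f x) x = a * T f x}.
Proof.
move=> Lf; case: hT => hT1 hT2 hT3.
(* Writing [a * f] as [(a - 1) * f + f] gives homogeneity without knowing [T 0] beforehand. *)
have /aeqP h := hT3 (a - 1) _ _ Lf Lf; apply: filterS h => x.
have -> : (fun x => (a - 1) * f x + f x) = (fun x => a * f x).
  by apply/funext => y; rewrite mulrBl mul1r subrK.
by move=> ->; rewrite mulrBl mul1r subrK.
Qed.

Lemma operatorD f g : L2Linf f -> L2Linf g ->
  {ae mu, forall x, T (fun x => f x + g x) x = T f x + T g x}.
Proof.
move=> Lf Lg; case: hT => _ _ /(_ 1 _ _ Lf Lg)/aeqP; apply: filterS => x.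
have -> : (fun x => 1 * f x + g x) = (fun x => f x + g x).
  by apply/funext => y; rewrite mul1r.
by rewrite mul1r.
Qed.

Lemma operator_L2Linf f : L2Linf f -> L2Linf (T f).
Proof. by case: hT => + _ _; exact. Qed.

Lemma operatorB f g : L2Linf f -> L2Linf g ->
  {ae mu, forall x, T (fun x => f x - g x) x = T f x - T g x}.
Proof.
move=> Lf Lg; have := operatorD Lf (L2LinfZ (-1) Lg); have := operatorZ (-1) Lg.
apply: filterS2 => x; have -> : (fun x => f x + -1 * g x) = (fun x => f x - g x).
  by apply/funext => y; rewrite mulN1r.
by move=> -> ->; rewrite mulN1r.
Qed.

Definition fock_pairs : set (H * H) :=
  [set p | exists2 i : nat * (X -> C), L2Linf i.2 & p = (B i.1 i.2, B i.1 (T i.2))].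

Let scaled_small (f : X -> C) (s : C) : L2Linf f -> 0 <= s -> s <= 1 ->
  (cnorm +oo%E f < (2^-1)%:E)%E ->
  (cnorm +oo%E (fun x => (s * f x)%R) < (2^-1)%:E)%E.
Proof.
move=> Lf s0 s1; apply: le_lt_trans; have n0 : (0 <= cnorm +oo%E f)%E by exact: Lnorm_ge0.
have [_ _ foo] := Lf.
have fM : (cnorm +oo%E f = (fine (cnorm +oo%E f))%:E)%E by rewrite fineK// ge0_fin_numE.
have M0 : 0 <= fine (cnorm +oo%E f) by rewrite fine_ge0.
rewrite [leRHS]fM; apply/cnormy_leP => //.
have /(cnormy_leP _ M0) : (cnorm +oo%E f <= (fine (cnorm +oo%E f))%:E)%E by rewrite -fM.
apply: filterS => x fx; rewrite sqnM; apply: le_trans fx.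
rewrite -[leRHS]mul1r ler_wpM2r ?sqn_ge0//.
have [s' s'0 se] := ge0_complexE s0; move: s1; rewrite se sqn_real lecR => s1.
by rewrite expr_le1.
Qed.

Let series_scaled (s : C) f (g : X -> C) : L2Linf f -> L2Linf g ->
  {ae mu, forall x, g x = s * f x} ->
  series (fun n => n`!%:R^-1 *: B n g) = series (fun n => s ^+ n *: (n`!%:R^-1 *: B n f)).
Proof.
move=> Lf Lg fg; congr series; apply/funext => n.
by rewrite (fock_scale hB n Lf Lg fg) !scalerA mulrC.
Qed.

Lemma fock_pair_mem_closure n f : L2Linf f -> closure (Gamma2 B T) (B n f, B n (T f)).
Proof.
have sG : linear_subspace (Gamma2 B T) by exact: linear_subspace_lspan.
have sGc := linear_subspace_closure sG.
wlog f2 : f / (cnorm +oo%E f < (2^-1)%:E)%E.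
  move=> wl Lf.
  have [q fq] := L2Linf_bounded Lf.
  (* With this factor [t * f] has sup norm at most 1/4; afterwards both components are divided by
     [t ^+ n]. *)
  pose t : R := (4 * (1 + `|q|))^-1.
  have t0 : 0 < t by rewrite invr_gt0 mulr_gt0// ltr_pwDl.
  have tc0 : t%:C != 0 :> C by rewrite fmorph_eq0 gt_eqF.
  have Ltf := L2LinfZ t%:C Lf.
  have tf2 : (cnorm +oo%E (fun x => (t%:C * f x)%R) < (2^-1)%:E)%E.
    apply: (@le_lt_trans _ _ (4^-1)%:E); last by rewrite lte_fin; lra.
    apply/cnormy_leP; first by rewrite invr_ge0.
    apply: filterS fq => x fx; rewrite sqnM sqn_real /t exprVn exprMn invfM -mulrA exprVn.
    rewrite ler_piMr ?invr_ge0 ?exprn_ge0// mulrC ler_pdivrMr ?exprn_gt0 ?ltr_pwDl// mul1r.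
    apply: le_trans fx _; have := ler_norm q; have := normr_ge0 q; nra.
  have := wl _ tf2 Ltf.
  rewrite (fock_scale hB n Lf Ltf (aeW _ (fun=> erefl))).
  rewrite (fock_scale hB n (operator_L2Linf Lf) (operator_L2Linf Ltf) (operatorZ t%:C Lf)).
  move=> /(linear_subspaceZ sGc ((t%:C ^+ n)^-1)).
  by rewrite scale_pair !scalerA mulVf ?expf_neq0// !scale1r.
move=> Lf; have LTf := operator_L2Linf Lf.
have Tf2 : (cnorm +oo%E (T f) < (2^-1)%:E)%E by exact: le_lt_trans (hTinf Lf) f2.
pose u n : H * H := (n`!%:R^-1 *: B n f, n`!%:R^-1 *: B n (T f)).
suff : closure (Gamma2 B T) (u n).
  move=> /(linear_subspaceZ sGc n`!%:R).
  by rewrite scale_pair !scalerA mulfV ?scale1r// pnatr_eq0 -lt0n fact_gt0.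
have [q [Q [r [[q0 Q0] [r0 r1] qr fb]]]] := sq_bounded_small Lf f2.
have [K K0 KP] := fock_norm_le c0 hB q0 Q0 r0 qr.
have [q' [Q' [r' [[q0' Q0'] [r0' r1'] qr' fb']]]] := sq_bounded_small LTf Tf2.
have [K' K0' KP'] := fock_norm_le c0 hB q0' Q0' r0' qr'.
(* The power series lives in [H * H], and its two components are bounded by separate geometric
   series. Since [T (s * f)] is [s * T f] only a.e., [fock_scale] identifies its number vectors. *)
apply: (@coef_mem_closure _ _ _ u ((K / (1 - r))%:C + (K' / (1 - r'))%:C)
   (fun s => (expvec B (fun x => s * f x), expvec B (T (fun x => s * f x))))) => //.
- move=> m; apply: (@le_trans _ _ (\sum_(k < m)
     (`|k`!%:R^-1 *: B k f| + `|k`!%:R^-1 *: B k (T f)|))).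
    by apply: ler_sum => k _; exact: norm_pair_le.
  rewrite big_split /= lerD//.
    by apply: (geometric_sum_le (u := fun k => `|k`!%:R^-1 *: B k f|)) => //;
      [exact: ltW|move=> k; exact: KP].
  by apply: (geometric_sum_le (u := fun k => `|k`!%:R^-1 *: B k (T f)|)) => //;
    [exact: ltW|move=> k; exact: KP'].
- move=> s s0 s1; have Lsf := L2LinfZ s Lf; have sf2 := scaled_small Lf (ltW s0) (ltW s1) f2.
  under eq_fun do rewrite series_pair.
  apply: cvg_pair.
    rewrite -(series_scaled Lf Lsf (aeW _ (fun=> erefl))); exact: expvec_cvg.
  rewrite -(series_scaled LTf (operator_L2Linf Lsf) (operatorZ s Lf)).
  apply: expvec_cvg; first exact: operator_L2Linf.
  exact: le_lt_trans (hTinf Lsf) sf2.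
move=> s s0 s1; apply: subset_closure; apply: sub_lspan.
exists (fun x => s * f x); split => //; first exact: L2LinfZ.
exact: scaled_small (ltW s0) (ltW s1) f2.
Qed.

Lemma closure_Gamma2 : closure (Gamma2 B T) = closure (lspan fock_pairs).
Proof.
have sG : linear_subspace (closure (Gamma2 B T)).
  exact/linear_subspace_closure/linear_subspace_lspan.
have sF : linear_subspace (closure (lspan fock_pairs)).
  exact/linear_subspace_closure/linear_subspace_lspan.
apply/seteqP; split.
  rewrite [X in _ `<=` X](closure_id _).1; last exact: closed_closure.
  apply: closure_subset; apply: lspan_sub => // _ [f [Lf f2 ->]].
  have LTf := operator_L2Linf Lf.
  have Tf2 : (cnorm +oo%E (T f) < (2^-1)%:E)%E by exact: le_lt_trans (hTinf Lf) f2.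
  apply: (@cvg_mem_closure _ _ _ (fun n => (series (fun n => n`!%:R^-1 *: B n f) n,
    series (fun n => n`!%:R^-1 *: B n (T f)) n))); last first.
    by apply: cvg_pair; exact: expvec_cvg.
  move=> n; rewrite -series_pair seriesEnat /=.
  apply: (linear_subspace_sum (linear_subspace_lspan _)) => i _.
  rewrite -scale_pair; apply: (linear_subspaceZ (linear_subspace_lspan _)).
  by apply: sub_lspan; exists (i, f).
rewrite [X in _ `<=` X](closure_id _).1; last exact: closed_closure.
apply: closure_subset; apply: lspan_sub => // _ [[n f] /= Lf ->].
exact: fock_pair_mem_closure.
Qed.

End second_quantization_graph.

(** * Weighted compositions with an involution *)

Section measure_preserving_involution.
Context {R : realType} {d : nat}.
Local Open Scope complex_scope.
Local Notation C := R[i].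
Local Notation X := (euclidean R d).
Local Notation mu := (lebesgue_euclidean R d).
Implicit Types f g : X -> C.

(** Extended by the identity, [phi] becomes a measure preserving involution of the whole space, so
    integrals can be transformed without restriction to [E]; the multiplier vanishes where the
    extension is arbitrary. *)
Definition extend_id (E : set X) (phi : X -> X) : X -> X :=
  fun x => if x \in E then phi x else x.

Section extend_id.
Context (E : set X) (phi : X -> X).
Hypotheses (mE : measurable E) (invphi : involution_on E phi).
Hypotheses (mphi : measurable_fun E phi) (mupphi : measure_preserving_on E phi).

Let preimage_extend_id A : extend_id E phi @^-1` A = (E `&` phi @^-1` A) `|` (A `\` E).
Proof.
apply/seteqP; split => x; rewrite /= /extend_id.
  by case: ifPn => [/set_mem Ex Ax|/negP xE Ax]; [left|right; split => // /mem_set].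
by move=> [[Ex Ax]|[Ax xE]]; [rewrite (mem_set Ex)|rewrite (memNset xE)].
Qed.

Lemma extend_idK : involutive (extend_id E phi).
Proof.
case: invphi => phiE phiK x; rewrite /extend_id.
have [xE|/negbTE xE] := boolP (x \in E); last by rewrite !xE.
rewrite (mem_set (phiE _ (set_mem xE))).
exact/phiK/set_mem.
Qed.

Lemma measurable_extend_id : measurable_fun setT (extend_id E phi).
Proof.
move=> _ A mA; rewrite setTI preimage_extend_id.
by apply: measurableU; [exact: mphi|exact: measurableD].
Qed.

Lemma measure_preserving_extend_id A : measurable A -> mu (extend_id E phi @^-1` A) = mu A.
Proof.
move=> mA; rewrite preimage_extend_id measureU//; last 3 first.
- exact: mphi.
- exact: measurableD.
- by apply/seteqP; split => // x [[Ex _] [_]].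
have -> : E `&` phi @^-1` A = E `&` phi @^-1` (A `&` E).
  by apply/seteqP; split => x /= [Ex]; [move=> Ax; split => //; split => //; exact: invphi.1|case].
transitivity (mu (A `&` E) + mu (A `\` E))%E.
  congr (_ + _)%E; exact: mupphi (measurableI A E mA mE) (@subIsetr _ A E).
rewrite -measureU ?setUIDK//; [exact: measurableI|exact: measurableD|].
by apply/seteqP; split => // x [[_ Ex] [_]].
Qed.

End extend_id.

Section change_of_variables.
Context (phi : X -> X) (mphi : measurable_fun setT phi).
Hypothesis mupphi : forall A, measurable A -> mu (phi @^-1` A) = mu A.

Lemma ge0_integral_preserving (u : X -> \bar R) : measurable_fun setT u ->
  (forall x, (0 <= u x)%E) -> (\int[mu]_x u (phi x) = \int[mu]_x u x)%E.
Proof.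
move=> mu_ u0.
have := @ge0_integral_pushforward _ _ X X R phi mphi mu setT u measurableT mu_ (fun x _ => u0 x).
rewrite preimage_setT => <-; apply: eq_measure_integral => A mA _.
exact: mupphi.
Qed.

Lemma Rintegral_preserving (u : X -> R) : measurable_fun setT u ->
  \int[mu]_x u (phi x) = \int[mu]_x u x.
Proof.
move=> mu_; rewrite /Rintegral; congr fine.
have mu' : measurable_fun setT (EFin \o u) by exact/measurable_EFinP.
rewrite integralE [RHS]integralE; congr (_ - _)%E.
  rewrite -[RHS]ge0_integral_preserving//; last exact: measurable_funepos.
  by apply: eq_integral => x _; rewrite !funeposE.
rewrite -[RHS]ge0_integral_preserving//; last exact: measurable_funeneg.
by apply: eq_integral => x _; rewrite !funenegE.
Qed.

Lemma cintegral_preserving f : measurable_cfun f ->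
  cintegral (fun x => f (phi x)) = cintegral f.
Proof.
move=> [mf1 mf2]; rewrite /cintegral.
by rewrite (Rintegral_preserving mf1) (Rintegral_preserving mf2).
Qed.

Lemma ae_preserving (P : X -> Prop) : {ae mu, forall x, P x} -> {ae mu, forall x, P (phi x)}.
Proof.
move=> [N [mN N0 PN]]; exists (phi @^-1` N); split.
- by rewrite -[X in measurable X]setTI; exact: mphi.
- by rewrite -[RHS]N0; exact: mupphi.
- by move=> x /= nP; exact: PN.
Qed.

End change_of_variables.

Section weighted_involution.
Context (phi : X -> X) (h : X -> C) (T : (X -> C) -> (X -> C)).
Hypotheses (mphi : measurable_fun setT phi) (phiK : involutive phi).
Hypothesis mupphi : forall A, measurable A -> mu (phi @^-1` A) = mu A.
Hypotheses (mh : measurable_cfun h) (h1 : {ae mu, forall x, sqn (h x) <= 1}).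
Hypothesis hphi : {ae mu, forall x, conjc (h x) = h (phi x)}.
Hypothesis hT1 : forall f, L2Linf f -> L2Linf (T f).
Hypothesis TE : forall f, L2Linf f -> {ae mu, forall x, T f x = h x * f (phi x)}.

(** The same [q] and [Q] serve for every iterate of [T], which is what bounds the number vectors
    along the orbit of [f]. *)
Lemma sq_bounded_weighted q Q f : sq_bounded q Q f -> sq_bounded q Q (T f).
Proof.
move=> fb; have Lf := sq_bounded_L2Linf fb; case: fb => mf fq fQ.
have mTf := L2Linf_measurable (hT1 Lf).
split => //.
  apply: filterS3 h1 (TE Lf) (ae_preserving mphi mupphi fq) => x hx -> fx.
  by rewrite sqnM -[leRHS]mul1r ler_pM// sqn_ge0.
apply: le_trans fQ; rewrite -[leRHS](ge0_integral_preserving mphi mupphi).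
- apply: ae_ge0_le_integral => //.
  + by move=> x _; rewrite lee_fin sqn_ge0.
  + by apply/measurable_EFinP; exact: measurable_sqn.
  + by move=> x _; rewrite lee_fin sqn_ge0.
  + apply/measurable_EFinP.
    exact: (measurable_sqn (measurable_cfun_comp mphi mf)).
  apply: filterS2 h1 (TE Lf) => x hx -> _; rewrite lee_fin sqnM.
  by rewrite -[leRHS]mul1r ler_wpM2r// sqn_ge0.
- by apply/measurable_EFinP; exact: measurable_sqn.
- by move=> x; rewrite lee_fin sqn_ge0.
Qed.

(** Substituting [phi x] for [x] moves the composition from one factor to the other, and
    [h (phi x) = conjc (h x)] moves the multiplier along. Powers commute with both operations. *)
Lemma L2inner_weighted_sym k f g : L2Linf f -> L2Linf g ->
  L2inner (fun x => f x ^+ k.+1) (fun x => T g x ^+ k.+1) =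
  L2inner (fun x => T f x ^+ k.+1) (fun x => g x ^+ k.+1).
Proof.
move=> Lf Lg; have [mf mg] := (L2Linf_measurable Lf, L2Linf_measurable Lg).
have [mTf mTg] := (L2Linf_measurable (hT1 Lf), L2Linf_measurable (hT1 Lg)).
pose u x := conjc ((h x * f (phi x)) ^+ k.+1) * g x ^+ k.+1.
have mu_ : measurable_cfun u.
  apply: measurable_cfunM; last exact: measurable_cfunX.
  apply/measurable_cfun_conj/measurable_cfunX/measurable_cfunM => //.
  exact: measurable_cfun_comp.
transitivity (cintegral u); last first.
  apply: eq_cintegral; [exact: mu_| |].
    apply: measurable_cfunM; last exact: measurable_cfunX.
    exact/measurable_cfun_conj/measurable_cfunX.
  by apply: filterS (TE Lf) => x ->.
rewrite -(cintegral_preserving mphi mupphi mu_); apply: eq_cintegral.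
- apply: measurable_cfunM; last exact: measurable_cfunX.
  exact/measurable_cfun_conj/measurable_cfunX.
- exact: measurable_cfun_comp.
apply: filterS2 hphi (TE Lg) => x hx ->.
have cM (a b : C) : conjc (a * b) = conjc a * conjc b by exact: rmorphM.
have cX (a : C) n : conjc (a ^+ n) = conjc a ^+ n by exact: rmorphXn.
rewrite /u phiK -hx !exprMn cM [conjc (conjc (h x) ^+ _)]cX conjcK.
by rewrite mulrCA mulrA.
Qed.

End weighted_involution.

End measure_preserving_involution.

Section weighted_involution_self_adjoint.
Context {R : realType} {d : nat} (H : completeNormedModType R[i]).
Context (dot : {dot H for Num.conj}) (c : R) (c0 : 0 < c) (Phi : H).
Context (B : nat -> (euclidean R d -> R[i]) -> H).
Hypothesis hB : quadratic_fock dot c Phi B.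
Local Open Scope complex_scope.
Local Notation C := R[i].
Local Notation X := (euclidean R d).
Local Notation mu := (lebesgue_euclidean R d).
Context (T : (X -> C) -> (X -> C)).
Hypotheses (hT : L2Linf_operator T) (hTinf : Linf_contraction T).

Lemma weighted_involution_self_adjoint (E : set X) (h : X -> C) (phi : X -> X) :
  measurable E -> measurable_cfun h -> (cnorm +oo%E h <= 1)%E ->
  involution_on E phi -> measurable_fun E phi -> measure_preserving_on E phi ->
  {ae mu, forall x, E x -> conjc (h x) = h (phi x)} ->
  (forall f, L2Linf f -> T f = (fun x => \1_E x * h x * f (phi x)) %[ae mu]) ->
  essentially_self_adjoint dot (Gamma2 B T).
Proof.
move=> mE mh h1 iphi mphi pphi hphi TE.
pose psi := extend_id E phi; pose k x := \1_E x * h x.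
have mpsi : measurable_fun setT psi by exact: measurable_extend_id.
have psiK : involutive psi by exact: extend_idK.
have ppsi A : measurable A -> mu (psi @^-1` A) = mu A by exact: measure_preserving_extend_id.
have mk : measurable_cfun k by apply: measurable_cfunM => //; exact: measurable_indicC.
have k1 : {ae mu, forall x, sqn (k x) <= 1}.
  have /(cnormy_leP _ ler01) := h1; rewrite expr1n; apply: filterS => x hx.
  by rewrite /k indicE; case: (_ \in _); rewrite ?mul1r// mul0r sqn0.
have kpsi : {ae mu, forall x, conjc (k x) = k (psi x)}.
  apply: filterS hphi => x hx; rewrite /k /psi /extend_id !indicE.
  have [xE|/negbTE xE] := boolP (x \in E); last by rewrite xE !mul0r conjc0.
  by rewrite (mem_set (iphi.1 _ (set_mem xE))) !mul1r hx//; exact: set_mem.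
have TE' f : L2Linf f -> {ae mu, forall x, T f x = k x * f (psi x)}.
  move=> /TE /aeqP; apply: filterS => x ->; rewrite /k /psi /extend_id indicE.
  by case: (_ \in _); rewrite ?mul0r.
have TL := operator_L2Linf hT.
have dotn := fock_inner_norm hB.
have symF n f g : L2Linf f -> L2Linf g ->
    inner dot (B n f) (B n (T g)) = inner dot (B n (T f)) (B n g).
  move=> Lf Lg; apply: (fock_innerS_eq hB n Lf (TL _ Lg) (TL _ Lf) Lg) => j.
   exact: (L2inner_weighted_sym mpsi psiK ppsi mk kpsi TL TE').
have symP : symmetric_rel dot (fock_pairs B T).
  move=> _ _ [[m f] /= Lf ->] [[n g] /= Lg ->] /=.
  have [->|mn] := eqVneq m n; first exact: symF.
  by rewrite !(fock_orthogonal hB)//; exact: TL.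
have ctrP p : lspan (fock_pairs B T) p -> `|p.2| <= `|p.1|.
  apply: (@symmetric_rel_contraction _ _ dot dotn (nat * (X -> C))%type [set i | L2Linf i.2]
    (fun i => B i.1 i.2) (fun i => (i.1, T i.2))).
  - by move=> [n f] /=; exact: TL.
  - move=> [n f] /= /L2LinfP[q [Q [mf fq fQ]]].
    pose q' := Num.max 0 q; pose Q' := Num.max 0 Q.
    have q'0 : 0 <= q' by rewrite le_max lexx.
    have Q'0 : 0 <= Q' by rewrite le_max lexx.
    have fb : sq_bounded q' Q' f.
      split => //; first by apply: filterS fq => x /le_trans; apply; rewrite le_max lexx orbT.
      by apply: le_trans fQ _; rewrite lee_fin le_max lexx orbT.
    (* Here [n] is fixed and only uniformity in the iterate matters, so any [r] with
       [4 * q' < r ^+ 2] will do, even one above 1. *)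
    have r0 : 0 < 1 + 4 * q' by rewrite ltr_pwDl// mulr_ge0.
    have [|K K0 KP] := fock_norm_le c0 hB q'0 Q'0 r0; first by nra.
    exists (n`!%:R * (K * (1 + 4 * q') ^+ n)%:C) => j.
    have -> : iter j (fun i : nat * (X -> C) => (i.1, T i.2)) (n, f) = (n, iter j T f).
      by elim: j => //= j ->.
    have Tb : sq_bounded q' Q' (iter j T f).
      by elim: j => //= j IH; exact: (sq_bounded_weighted mpsi ppsi k1 TL TE').
    have := KP _ Tb n; rewrite normrZ ger0_norm ?invr_ge0//= => KPn.
    by rewrite -ler_pdivrMl// ltr0n fact_gt0.
  - move=> [m f] [n g] /= Lf Lg.
    have [->|mn] := eqVneq m n; first exact: symF.
    by rewrite !(fock_orthogonal hB)//; exact: TL.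
have sF : linear_subspace (lspan (fock_pairs B T)) by exact: linear_subspace_lspan.
have denseF : closure [set u | exists v, lspan (fock_pairs B T) (u, v)] = setT.
  rewrite -subTset -(fock_total hB); apply: closure_subset.
  apply: lspan_sub.
    split; first by exists 0; exact: (linear_subspace0 sF).
    move=> a u v [u' Fu] [v' Fv]; exists (a *: u' + v').
    exact: (linear_subspaceD sF (linear_subspaceZ sF a Fu) Fv).
  by move=> _ [n [f [Lf ->]]]; exists (B n (T f)); apply: sub_lspan; exists (n, f).
have saG : self_adjoint dot (closure (Gamma2 B T)).
  rewrite (closure_Gamma2 c0 hB hT hTinf).
  by apply: self_adjoint_closure => //; exact: symmetric_rel_lspan.
split => //; last by case: saG.
have [_ dG _] := saG.
(* Density is required of the domain of [Gamma2 B T] itself; the domain of its closure lies in the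
   closure of that domain. *)
rewrite /densely_defined -subTset -dG.
rewrite [X in _ `<=` X](closure_id _).1; last exact: closed_closure.
apply: closure_subset.
by move=> u [v]; exact: closure_fst.
Qed.

End weighted_involution_self_adjoint.

(** * Products and the set homomorphism of a symmetric operator *)

Section self_adjoint_identities.
Context {R : realType} {d : nat} (H : completeNormedModType R[i]).
Context (dot : {dot H for Num.conj}) (c : R) (c0 : 0 < c) (Phi : H).
Context (B : nat -> (euclidean R d -> R[i]) -> H).
Hypothesis hB : quadratic_fock dot c Phi B.
Local Open Scope complex_scope.
Local Notation C := R[i].
Local Notation X := (euclidean R d).
Local Notation mu := (lebesgue_euclidean R d).
Context (T : (X -> C) -> (X -> C)).
Hypotheses (hT : L2Linf_operator T) (hTinf : Linf_contraction T).
Hypothesis saT : essentially_self_adjoint dot (Gamma2 B T).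
Implicit Types f g : X -> C.

(** Both number pairs lie in the closed graph, which coincides with its own adjoint. *)
Lemma fock_inner_sym n f g : L2Linf f -> L2Linf g ->
  inner dot (B n f) (B n (T g)) = inner dot (B n (T f)) (B n g).
Proof.
move=> Lf Lg; have [_ _ [_ _ adj]] := saT.
have := fock_pair_mem_closure c0 hB hT hTinf (n := n) Lf; rewrite -adj; apply.
exact: (fock_pair_mem_closure c0 hB hT hTinf).
Qed.

Let cC0 : real_complex R c != 0.
Proof. by rewrite fmorph_eq0 gt_eqF. Qed.

Lemma L2inner_sym f g : L2Linf f -> L2Linf g -> L2inner f (T g) = L2inner (T f) g.
Proof.
move=> Lf Lg; have [LTf LTg] := (operator_L2Linf hT Lf, operator_L2Linf hT Lg).
have := fock_inner_sym 1 Lf Lg; rewrite !(fock_inner hB)//.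
move=> /(mulfI cC0); rewrite !big_nat1 /= !(fock_inner0 hB)// !mulr1.
have E1 (k : X -> C) : (fun x => k x ^+ 1) = k by apply/funext => x; rewrite expr1.
by rewrite !E1 => /mulfI; apply; rewrite !mulf_neq0 ?invr_neq0 ?expf_neq0 ?pnatr_eq0.
Qed.

(** For [n = 2] the recursion has two terms. The one with [<f, g>] and the one-particle inner
    product is symmetric by the case [n = 1] and cancels, leaving the inner product of squares. *)
Lemma L2inner_sqr_sym f g : L2Linf f -> L2Linf g ->
  L2inner (fun x => f x ^+ 2) (fun x => T g x ^+ 2) =
  L2inner (fun x => T f x ^+ 2) (fun x => g x ^+ 2).
Proof.
move=> Lf Lg; have [LTf LTg] := (operator_L2Linf hT Lf, operator_L2Linf hT Lg).
have := fock_inner_sym 2 Lf Lg; rewrite !(fock_inner hB)//.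
move=> /(mulfI cC0); rewrite !big_nat_recr//= !big_geq// !add0r.
have E1 (k : X -> C) : (fun x => k x ^+ 1) = k by apply/funext => x; rewrite expr1.
rewrite !E1 L2inner_sym// (fock_inner_sym 1)// => /addrI.
rewrite !(fock_inner0 hB)// !mulr1 => /mulfI; apply.
by rewrite mulf_neq0// ?invr_neq0 ?pnatr_eq0// mulf_neq0 ?expf_neq0// ?pnatr_eq0.
Qed.

End self_adjoint_identities.

Section products.
Context {R : realType} {d : nat}.
Local Open Scope complex_scope.
Local Notation C := R[i].
Local Notation X := (euclidean R d).
Local Notation mu := (lebesgue_euclidean R d).
Context (T : (X -> C) -> (X -> C)) (hT : L2Linf_operator T).
Implicit Types f g k : X -> C.
Hypothesis symT : forall f g, L2Linf f -> L2Linf g -> L2inner f (T g) = L2inner (T f) g.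
Hypothesis sym2T : forall f g, L2Linf f -> L2Linf g ->
  L2inner (fun x => f x ^+ 2) (fun x => T g x ^+ 2) =
  L2inner (fun x => T f x ^+ 2) (fun x => g x ^+ 2).
Context (w : X -> R) (mw : measurable_fun setT w) (w0 : forall x, 0 < w x).
Let W x := (w x)%:C.
Hypothesis LW : L2Linf W.

Let TL := operator_L2Linf hT.

Lemma eq_L2inner_conjM f g f' g' : L2Linf f -> L2Linf g -> L2Linf f' -> L2Linf g' ->
  {ae mu, forall x, conjc (f x) * g x = conjc (f' x) * g' x} -> L2inner f g = L2inner f' g'.
Proof.
move=> Lf Lg Lf' Lg'; apply: eq_cintegral; apply: measurable_cfunM.
- exact/measurable_cfun_conj/L2Linf_measurable.
- exact: L2Linf_measurable.
- exact/measurable_cfun_conj/L2Linf_measurable.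
- exact: L2Linf_measurable.
Qed.

Lemma L2inner_disjoint f g : L2Linf f -> L2Linf g ->
  {ae mu, forall x, f x = 0 \/ g x = 0} -> L2inner f g = 0.
Proof.
move=> Lf Lg fg; transitivity (L2inner (fun x => 0 * f x) f); last first.
  by rewrite L2innerZl// conjc0 mul0r.
apply: eq_L2inner_conjM => //; first exact: L2LinfZ.
by apply: filterS fg => x [->|->]; rewrite !(conjc0, mul0r, mulr0).
Qed.

Lemma polarize f g1 g2 : L2Linf f -> L2Linf g1 -> L2Linf g2 ->
  L2inner f (fun x => (g1 x + g2 x) ^+ 2) - L2inner f (fun x => (g1 x - g2 x) ^+ 2) =
  4 * L2inner f (fun x => g1 x * g2 x).
Proof.
move=> Lf L1 L2; rewrite -L2innerBr//; [|exact/(L2LinfX 1)/L2LinfD|exact/(L2LinfX 1)/L2LinfB].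
rewrite -L2innerZr//; last exact: L2LinfM.
by congr L2inner; apply/funext => x; ring.
Qed.

(** Squaring involves no conjugation, so the two-term identity [(a + b)^2 - (a - b)^2 = 4ab]
    suffices to polarize. *)
Lemma L2inner_sqr_polar f g1 g2 : L2Linf f -> L2Linf g1 -> L2Linf g2 ->
  L2inner (fun x => f x ^+ 2) (fun x => T g1 x * T g2 x) =
  L2inner (fun x => T f x ^+ 2) (fun x => g1 x * g2 x).
Proof.
move=> Lf L1 L2; apply: (@mulfI _ (4 : C)); first by rewrite pnatr_eq0.
have Lf2 := L2LinfX 1 Lf; have LTf2 := L2LinfX 1 (TL Lf).
rewrite -!polarize//; try exact: TL.
have LD := L2LinfD L1 L2; have LB := L2LinfB L1 L2.
rewrite -(sym2T Lf LD) -(sym2T Lf LB); congr (_ - _).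
  apply: eq_L2inner => //; [by apply/(L2LinfX 1)/L2LinfD; exact: TL|exact/(L2LinfX 1)/TL|exact: aeW|].
  by apply: filterS (operatorD hT L1 L2) => x ->.
apply: eq_L2inner => //; [by apply/(L2LinfX 1)/L2LinfB; exact: TL|exact/(L2LinfX 1)/TL|exact: aeW|].
by apply: filterS (operatorB hT L1 L2) => x ->.
Qed.

(** Polarization in the remaining argument, which conjugation first brings to the linear side. *)
Lemma L2inner_polar f1 f2 g1 g2 : L2Linf f1 -> L2Linf f2 -> L2Linf g1 -> L2Linf g2 ->
  L2inner (fun x => f1 x * f2 x) (fun x => T g1 x * T g2 x) =
  L2inner (fun x => T f1 x * T f2 x) (fun x => g1 x * g2 x).
Proof.
move=> L1 L2 Lg1 Lg2; have [LT1 LT2] := (TL Lg1, TL Lg2).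
rewrite L2inner_conj; [|exact: L2LinfM..].
rewrite [RHS]L2inner_conj; [|apply: L2LinfM => //; exact: TL|apply: L2LinfM => //; exact: TL].
congr conjc; apply: (@mulfI _ (4 : C)); first by rewrite pnatr_eq0.
have Lg := L2LinfM Lg1 Lg2; have LTg := L2LinfM LT1 LT2.
rewrite -!polarize//; try exact: TL.
have LD := L2LinfD L1 L2; have LB := L2LinfB L1 L2.
have key f : L2Linf f -> L2inner (fun x => T g1 x * T g2 x) (fun x => f x ^+ 2) =
    L2inner (fun x => g1 x * g2 x) (fun x => T f x ^+ 2).
  move=> Lf; rewrite L2inner_conj; [|exact: (L2LinfX 1)|by []].
  rewrite L2inner_sqr_polar// [RHS]L2inner_conj//.
  exact/(L2LinfX 1)/TL.
rewrite (key _ LD) (key _ LB); congr (_ - _).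
  apply: eq_L2inner => //; [exact/(L2LinfX 1)/TL|by apply/(L2LinfX 1)/L2LinfD; exact: TL|exact: aeW|].
  by apply: filterS (operatorD hT L1 L2) => x ->.
apply: eq_L2inner => //; [exact/(L2LinfX 1)/TL|by apply/(L2LinfX 1)/L2LinfB; exact: TL|exact: aeW|].
by apply: filterS (operatorB hT L1 L2) => x ->.
Qed.

Lemma weight_neq0 x : W x != 0. Proof. by rewrite fmorph_eq0 gt_eqF. Qed.

(* By polarization [<f1 f2, T g1 * T g2>] depends on [g1 * g2] only. *)
Lemma operator_prod g1 g2 g3 g4 : L2Linf g1 -> L2Linf g2 -> L2Linf g3 -> L2Linf g4 ->
  (forall x, g1 x * g2 x = g3 x * g4 x) ->
  {ae mu, forall x, T g1 x * T g2 x = T g3 x * T g4 x}.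
Proof.
move=> L1 L2 L3 L4 g1234; pose k x := T g1 x * T g2 x - T g3 x * T g4 x.
have L12 := L2LinfM (TL L1) (TL L2); have L34 := L2LinfM (TL L3) (TL L4).
have Lk : L2Linf k by exact: L2LinfB.
have LWk : L2Linf (fun x => W x * k x) by exact: L2LinfM.
(* The test function [W * k] supplies the product [f1 * f2] on the left of [L2inner_polar]. *)
suff /(L2inner_weight_eq0 mw w0 Lk LWk) : L2inner k (fun x => W x * k x) = 0.
  by apply: filterS => x /eqP; rewrite subr_eq0 => /eqP.
rewrite L2inner_conj// L2innerBr// !L2inner_polar//.
have -> : (fun x => g1 x * g2 x) = (fun x => g3 x * g4 x) by exact/funext.
by rewrite subrr conjc0.
Qed.

(** The product rule gives [(T (W f))^2 = T W * T (W f^2)]. *)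
Let TW0 (f : X -> C) : L2Linf f -> {ae mu, forall x, T W x = 0 -> T (fun x => W x * f x) x = 0}.
Proof.
move=> Lf; have LWf := L2LinfM LW Lf; have LWf2 := L2LinfM LWf Lf.
have h x : W x * f x * (W x * f x) = W x * (W x * f x * f x) by ring.
have := operator_prod LWf LWf LW LWf2 h.
apply: filterS => x + TW; rewrite TW mul0r => /eqP.
by rewrite mulf_eq0 orbb => /eqP.
Qed.

(** Since [f / W] may leave the space, [TW0] does not apply to [f] itself. Let [b] be [T f] cut down
    to [{T W = 0}]. As [T (W * T b)] vanishes there, [<T b, W * T b> = <b, T (W * T b)> = 0], so
    [T b = 0]; then [<b, b> = <b, T f> = <T b, f> = 0]. *)
Lemma operator_eq0 f : L2Linf f -> {ae mu, forall x, T W x = 0 -> T f x = 0}.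
Proof.
move=> Lf; pose Z := [set x | T W x = 0].
have mZ : measurable Z.
  apply: measurable_cfun_eq; last exact: measurable_cfun_cst.
  exact/L2Linf_measurable/TL.
pose b x := \1_Z x * T f x; have Lb : L2Linf b by exact/L2Linf_indicM/TL.
have LWb := L2LinfM LW (TL Lb).
have Tb0 : {ae mu, forall x, T b x = 0}.
  apply: (L2inner_weight_eq0 mw w0 (TL Lb) LWb).
  rewrite -symT//; apply: L2inner_disjoint => //; first exact: TL.
  apply: filterS (TW0 (TL Lb)) => x TWx.
  have [/TWx|xZ] := pselect (T W x = 0); first by right.
  by left; rewrite /b indicE memNset// mul0r.
have b0 : {ae mu, forall x, b x = 0}.
  apply: (L2inner_eq0 Lb); transitivity (L2inner b (T f)).
    apply: eq_L2inner_conjM => //; first exact: TL.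
    apply: aeW => x; rewrite /b indicE.
    by case: (_ \in _); rewrite ?mul1r// !mul0r conjc0 !mul0r.
  rewrite symT//; apply: L2inner_disjoint => //; first exact: TL.
  by apply: filterS Tb0 => x; left.
apply: filterS b0 => x + TWx; rewrite /b indicE mem_set// mul1r//.
Qed.

(* [T (1_A W)] turns out to be [1_S (T W)] a.e. with [S = transported A], so
   that [A |-> S] is a homomorphism of sigma-algebras modulo null sets. *)
Definition transported (A : set X) : set X :=
  [set x | T (fun y => \1_A y * W y) x = T W x].

Let L1W A : measurable A -> L2Linf (fun y => \1_A y * W y).
Proof. by move=> mA; exact: L2Linf_indicM. Qed.

Lemma measurable_transported A : measurable A -> measurable (transported A).
Proof.
by move=> mA; apply: measurable_cfun_eq; apply: L2Linf_measurable; apply: TL => //; exact: L1W.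
Qed.

Lemma transported_setT : transported setT = setT.
Proof.
rewrite /transported -subTset => x _ /=; congr (T _ _).
by apply/funext => y; rewrite indicT mul1r.
Qed.

(** As [1_A] is idempotent, the product rule gives [T (1_A W)^2 = T (1_A W) * T W]: pointwise the
    value is either 0 or [T W]. *)
Lemma transportedN A : measurable A ->
  {ae mu, forall x, ~ transported A x -> T (fun y => \1_A y * W y) x = 0}.
Proof.
move=> mA; have := operator_prod (L1W mA) (L1W mA) (L1W mA) LW (fun x => _).
have h x : \1_A x * W x * (\1_A x * W x) = \1_A x * W x * W x.
  by rewrite indicE; case: (_ \in _); rewrite ?mul1r// !mul0r.
move=> /(_ h); apply: filterS => x /eqP; rewrite -subr_eq0 -mulrBr mulf_eq0 subr_eq0.
by move=> /orP[/eqP//|/eqP + /(_ _)/wrap[]].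
Qed.

Lemma transportedC A : measurable A ->
  {ae mu, forall x, T W x != 0 -> (transported (~` A) x <-> ~ transported A x)}.
Proof.
move=> mA; have h : (fun y => \1_(~` A) y * W y) = (fun y => W y - \1_A y * W y).
  apply/funext => y; rewrite !indicE in_setC.
  by case: (_ \in _); rewrite ?mul1r ?mul0r ?subrr ?subr0.
have := operatorB hT LW (L1W mA); rewrite -h.
apply: filterS2 (transportedN mA) => x xA TB TW; rewrite /transported /= TB.
split=> [/eqP|nA]; last by rewrite xA// subr0.
rewrite -subr_eq0 addrAC subrr sub0r oppr_eq0 => /eqP -> /esym/eqP.
by rewrite (negbTE TW).
Qed.

(* Countable additivity needs no limit: if [b] is supported where no [A n] is
   transported, then [T b] is orthogonal to every [1_(A n) W g], so that [T b]
   vanishes on the union of the [A n]. *)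
Lemma transported_bigcup (A : (set X)^nat) : (forall n, measurable (A n)) ->
  {ae mu, forall x, T W x != 0 ->
    (transported (\bigcup_n A n) x <-> exists n, transported (A n) x)}.
Proof.
move=> mA; set U := \bigcup_n A n; have mU : measurable U by exact: bigcupT_measurable.
pose t (D : set X) := T (fun y => \1_D y * W y).
have Lt D : measurable D -> L2Linf (t D) by move=> mD; exact/TL/L1W.
(* [N] is where countable additivity could fail in the nontrivial direction; the aim is that [b],
   which is [T W] cut down to [N], vanishes. *)
pose N := [set x | T W x != 0] `&` transported U `&` \bigcap_n ~` transported (A n).
have mN : measurable N.
  apply: measurableI; first apply: measurableI.
  - rewrite [X in measurable X](_ : _ = ~` [set x | T W x = 0]).
      apply: measurableC; apply: measurable_cfun_eq; last exact: measurable_cfun_cst.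
      exact/L2Linf_measurable/TL.
    by apply/seteqP; split => x /= /eqP.
  - exact: measurable_transported.
  - by apply: bigcapT_measurable => n; exact: (measurableC (measurable_transported (mA n))).
pose b x := \1_N x * T W x; have Lb : L2Linf b by exact/L2Linf_indicM/TL.
have LTb := TL Lb; have LWb := L2LinfM LW LTb.
have tA0 : {ae mu, forall x, forall n, ~ transported (A n) x -> t (A n) x = 0}.
  by apply: ae_foralln => n; exact: transportedN.
have TbA : {ae mu, forall x, forall n, \1_(A n) x * T b x = 0}.
  apply: ae_foralln => n; pose k x := \1_(A n) x * T b x.
  have Lk : L2Linf k by exact: L2Linf_indicM.
  have LWk := L2LinfM LW Lk.
  apply: (L2inner_weight_eq0 mw w0 Lk LWk).
  transitivity (L2inner (T b) (fun x => W x * k x)).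
    apply: eq_L2inner_conjM => //; apply: aeW => x; rewrite /k indicE.
    by case: (_ \in _); rewrite ?mul1r// !mul0r mulr0 !mulr0.
  rewrite -symT//; apply: L2inner_disjoint => //; first exact: TL.
  (* By the product rule [T (W k) * T W = T (1_(A n) W) * T (W * T b)]. On [N] the right-hand side
     is 0 and [T W] is not, so [T (W k)] and [b] are disjoint. *)
  have h x : W x * k x * W x = \1_(A n) x * W x * (W x * T b x) by rewrite /k; ring.
  have := operator_prod LWk LW (L1W (mA n)) LWb h.
  apply: filterS2 tA0 => x tx E.
  have [[[TW _] /(_ n Logic.I) /tx tAn]|xN] := pselect (N x).
    by right; move/eqP : E; rewrite [X in _ == X * _]tAn mul0r mulf_eq0 (negbTE TW) orbF => /eqP.
  by left; rewrite /b indicE memNset// mul0r.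
(* On [N] one has [T (1_U W) = T W], so [<b, b> = <b, T (1_U W)> = <T b, 1_U W>], and [T b] vanishes
   on [U]. *)
have b0 : {ae mu, forall x, b x = 0}.
  apply: (L2inner_eq0 Lb); transitivity (L2inner b (t U)).
    apply: eq_L2inner_conjM => //; first exact: Lt.
    apply: aeW => x; rewrite /b indicE; have [|_] := boolP (x \in N); last first.
      by rewrite !mul0r conjc0 !mul0r.
    by move=> /set_mem[[_ +] _]; rewrite /transported /= /t => ->; rewrite mul1r.
  rewrite symT//; last exact: L1W.
  apply: L2inner_disjoint => //; first exact: L1W.
  apply: filterS TbA => x Tbx; have [[n _ An]|xU] := pselect (U x).
    by left; have := Tbx n; rewrite indicE mem_set// mul1r.
  by right; rewrite indicE memNset// mul0r.
(* The other direction: [1_(A n) * 1_U = 1_(A n)] and the product rule allow cancelling [T W] where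
   [A n] is transported. *)
have prodA : {ae mu, forall x, forall n, t (A n) x * t U x = t (A n) x * T W x}.
  apply: ae_foralln => n; apply: operator_prod; [exact: L1W..|exact: LW|] => x.
  rewrite !indicE; have [xA|] := boolP (x \in A n); last by rewrite !mul0r.
  have -> : x \in U by apply/mem_set; exists n => //; exact: set_mem.
  by rewrite !mul1r.
apply: filterS2 b0 prodA => x bx px TW; split => [tU|[n tn]]; last first.
  have := px n; by rewrite [t (A n) x]tn => /(mulfI TW).
apply: contrapT => nA; move: bx; rewrite /b indicE mem_set ?mul1r.
  by move=> E; move: TW; rewrite E eqxx.
split=> [|n _ An]; first by split.
by apply: nA; exists n.
Qed.

End products.

(** * Realization of a set homomorphism by a point map *)

Section point_realization.
Context {R : realType} {dY dV} {Y : measurableType dY} {V : measurableType dV}.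
Context (m : {measure set Y -> \bar R}) (good : set Y) (P : set V -> set Y).
Hypothesis mP : forall A, measurable A -> measurable (P A).
Hypothesis P_setT : P setT = setT.
Hypothesis P_setC : forall A, measurable A ->
  {ae m, forall x, good x -> (P (~` A) x <-> ~ P A x)}.
Hypothesis P_bigcup : forall A : (set V)^nat, (forall n, measurable (A n)) ->
  {ae m, forall x, good x -> (P (\bigcup_n A n) x <-> exists n, P (A n) x)}.

(** The sets on which [P] acts through [u] form a sigma-algebra, so it is enough to verify
    generators. *)
Definition realized dZ (Z : measurableType dZ) (v : V -> Z) (u : Y -> Z) : set (set Z) :=
  [set D | measurable (v @^-1` D) /\ {ae m, forall x, good x -> (P (v @^-1` D) x <-> D (u x))}].

Lemma realized_sigma_algebra dZ (Z : measurableType dZ) (v : V -> Z) (u : Y -> Z) :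
  sigma_algebra setT (realized v u).
Proof.
split.
- split; first by rewrite preimage_set0.
  have := P_setC (@measurableT _ V); rewrite setCT preimage_set0 P_setT.
  by apply: filterS => x /[apply] PE; split=> [/PE/(_ Logic.I)|//].
- move=> A [mA PA]; rewrite setTD; split; first by rewrite preimage_setC; exact: measurableC.
  rewrite preimage_setC; apply: filterS2 PA (P_setC mA) => x PA PC gx.
  have [CP PC'] := PC gx; have [AP PA'] := PA gx.
  split=> [/CP nP Au|nA]; first exact/nP/PA'.
  by apply: PC' => /AP.
- move=> A mA; have mvA n : measurable (v @^-1` A n) by have [] := mA n.
  split; first by rewrite preimage_bigcup; exact: bigcupT_measurable.
  rewrite preimage_bigcup.
  have : {ae m, forall x, forall n, good x -> (P (v @^-1` A n) x <-> A n (u x))}.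
    by apply: ae_foralln => n; have [] := mA n.
  apply: filterS2 (P_bigcup mvA) => x PU PA gx.
  split; first by case/(PU gx) => n /(PA n gx) Anu; exists n.
  by case=> n _ /(PA n gx) PAn; apply/(PU gx); exists n.
Qed.

Let P_bigcup_rat (A : rat -> set V) : (forall q, measurable (A q)) ->
  {ae m, forall x, good x -> (P (\bigcup_q A q) x <-> exists q, P (A q) x)}.
Proof.
move=> mA; pose dec n : rat := odflt 0 (unpickle n).
have -> : \bigcup_q A q = \bigcup_n A (dec n).
  apply/seteqP; split=> x [q _ Aq]; last by exists (dec q).
  by exists (pickle q) => //; rewrite /dec pickleK.
have := P_bigcup (fun n => mA (dec n)); apply: filterS => x h gx.
rewrite (h gx); split=> [[n PA]|[q PA]]; first by exists (dec n).
by exists (pickle q); rewrite /dec pickleK.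
Qed.

(** [u x] is the infimum of the rationals [q] with [x] in [P {v < q}]. Countable unions make
    [P {v < r}] agree, a.e. on [good], with the union of [P {v < q}] over rational [q < r], that is
    with [{u < r}]. *)
Lemma real_point_realization (v : V -> R) : measurable_fun setT v ->
  exists2 u : Y -> R, measurable_fun setT u & forall D : set R, measurable D ->
    {ae m, forall x, good x -> (P (v @^-1` D) x <-> D (u x))}.
Proof.
move=> mv; pose U (r : R) := v @^-1` `]-oo, r[.
have mU r : measurable (U r).
  by rewrite /U -[X in measurable X]setTI; apply: mv => //; exact: measurable_itv.
have key r : {ae m, forall x, good x ->
    (P (U r) x <-> exists2 q : rat, ratr q < r & P (U (ratr q)) x)}.
  pose A (q : rat) := if ratr q < r then U (ratr q) else set0.
  have -> : U r = \bigcup_q A q.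
    apply/seteqP; split=> y; rewrite /U /=.
      rewrite in_itv /= => /rat_in_itvoo[q]; rewrite in_itv /= => /andP[vq qr].
      by exists q => //; rewrite /A qr /U /= in_itv.
    by case=> q _; rewrite /A /=; case: ifPn => // qr; rewrite /U /= !in_itv /= => /lt_trans; exact.
  have mA q : measurable (A q) by rewrite /A; case: ifPn.
  (* [P set0] may be nonempty; it only misses [good] up to a null set. *)
  have := P_setC (@measurableT _ V); rewrite setCT P_setT.
  apply: filterS2 (P_bigcup_rat mA) => x PU P0 gx; rewrite (PU gx).
  split=> [[q]|[q qr PUq]]; last by exists q; rewrite /A qr.
  rewrite /A; case: ifPn => [qr PUq|_ P0x]; first by exists q.
  by have [/(_ P0x)/(_ Logic.I)] := P0 gx.
(* [G] is where the infimum is taken over a nonempty set bounded below; elsewhere [u] has the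
   default value 0. *)
pose G := [set x | (exists q : rat, P (U (ratr q)) x) /\
  exists n : nat, forall q : rat, ratr q < - n%:R :> R -> ~ P (U (ratr q)) x].
pose S x := [set r : R | exists2 q : rat, r = ratr q & P (U (ratr q)) x].
have Gn0 x : G x -> S x !=set0 by move=> [[q Pq] _]; exists (ratr q), q.
have Glb x : G x -> has_lbound (S x).
  move=> [_ [n Gn]]; exists (- n%:R) => _ [q -> Pq]; rewrite leNgt.
  by apply/negP => /Gn.
have mG : measurable G.
  rewrite [X in measurable X](_ : _ = (\bigcup_(q : rat) P (U (ratr q))) `&`
      \bigcup_n ~` \bigcup_(q : rat) (if ratr q < - n%:R :> R then P (U (ratr q)) else set0)).
    apply: measurableI; first by apply: bigcupT_measurable_rat => q; exact: mP.
    apply: bigcupT_measurable => n; apply: measurableC.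
    by apply: bigcupT_measurable_rat => q; case: ifPn => // _; exact: mP.
  apply/seteqP; split=> x.
    move=> [[q Pq] [n Gn]]; split; first by exists q.
    by exists n => // -[r _]; case: ifPn => // rn; exact: Gn.
  move=> [[q _ Pq] [n _ Gn]]; split; first by exists q.
  exists n => r rn Pr; apply: Gn; exists r => //.
  by rewrite rn.
pose u x := if x \in G then inf (S x) else 0.
have ulP x r : G x -> u x < r <-> exists2 q : rat, ratr q < r & P (U (ratr q)) x.
  move=> Gx; rewrite /u mem_set//; split.
    by move=> /(inf_lt (Gn0 x Gx))[_ [q -> Pq] qr]; exists q.
  move=> [q qr Pq]; apply: le_lt_trans qr; apply: (ge_inf (Glb x Gx)).
  by exists q.
have mu_ : measurable_fun setT u.
  move=> _; apply: (measurability _ (RGenInftyO.measurableE R)) => //.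
  move=> _ [_ [r ->] <-]; rewrite setTI.
  rewrite [X in measurable X](_ : _ = (G `&` \bigcup_(q : rat)
      (if ratr q < r then P (U (ratr q)) else set0)) `|`
      (~` G `&` (if 0 < r then setT else set0))).
    apply: measurableU; apply: measurableI => //.
    - by apply: bigcupT_measurable_rat => q; case: ifPn => // _; exact: mP.
    - exact: measurableC.
    - by case: ifPn.
  apply/seteqP; split=> x /=; rewrite in_itv /=.
    move=> uxr; have [Gx|nGx] := pselect (G x).
      left; split => //; have [q qr Pq] := (ulP x r Gx).1 uxr.
      by exists q => //; rewrite qr.
    by right; split => //; move: uxr; rewrite /u memNset// => ->.
  move=> [[Gx [q _]]|[nGx]].
    by case: ifPn => // qr Pq; apply/(ulP x r Gx); exists q.
  by rewrite /u memNset//; case: ifPn.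
exists u => // D mD.
suff : realized v u D by case.
suff : (@ocitv R).-sigma.-measurable `<=` realized v u by apply.
rewrite RGenInftyO.measurableE; apply: smallest_sub; first exact: realized_sigma_algebra.
move=> _ [r ->]; split; first exact: mU.
(* Nonemptiness comes from covering the space by the sets [{v < q}], boundedness below from covering
   it by the complements of [{v < -n}]. *)
have goodG : {ae m, forall x, good x -> G x}.
  have n1 : {ae m, forall x, good x -> exists q : rat, P (U (ratr q)) x}.
    have := P_bigcup_rat (fun q : rat => mU (ratr q)).
    have -> : \bigcup_(q : rat) U (ratr q) = setT.
      apply/seteqP; split => // y _.
      have /rat_in_itvoo[q] : v y < v y + 1 by rewrite ltrDl.
      by rewrite in_itv /= => /andP[vq _]; exists q => //; rewrite /U /= in_itv.
    by rewrite P_setT; apply: filterS => x h /h[/(_ Logic.I)].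
  have mCU n : measurable (~` U (- n%:R)) by exact: measurableC.
  have := P_bigcup mCU.
  have -> : \bigcup_n ~` U (- n%:R) = setT.
    apply/seteqP; split => // y _; exists (Num.bound `|v y|) => //.
    rewrite /U /= in_itv /=; apply/negP; rewrite -leNgt lerNl.
    by rewrite (le_trans (ler_norm _))// normrN ltW// archi_boundP.
  rewrite P_setT => n2.
  have n3 : {ae m, forall x, forall n, good x -> (P (~` U (- n%:R)) x <-> ~ P (U (- n%:R)) x)}.
    by apply: ae_foralln => n; exact: P_setC.
  have n4 := ae_foralln (fun n : nat => key (- n%:R)).
  have n5 : {ae m, forall x, good x ->
      exists n : nat, forall q : rat, ratr q < - n%:R :> R -> ~ P (U (ratr q)) x}.
    apply: filterS3 n2 n3 n4 => x h2 h3 h4 gx.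
    have [/(_ Logic.I)[n /(h3 n gx) nP] _] := h2 gx.
    by exists n => q qn Pq; apply: nP; apply/(h4 n gx); exists q.
  by apply: filterS2 n1 n5 => x h1 h5 gx; split; [exact: h1|exact: h5].
apply: filterS2 goodG (key r) => x xG xk gx.
by rewrite (xk gx) /= in_itv /= (ulP x r (xG gx)).
Qed.

End point_realization.

Lemma euclidean_point_realization {R : realType} {d : nat} {dY} {Y : measurableType dY}
    (m : {measure set Y -> \bar R}) (good : set Y) (P : set (euclidean R d) -> set Y) :
  (forall A, measurable A -> measurable (P A)) ->
  P setT = setT ->
  (forall A, measurable A -> {ae m, forall x, good x -> (P (~` A) x <-> ~ P A x)}) ->
  (forall A : (set (euclidean R d))^nat, (forall n, measurable (A n)) ->
    {ae m, forall x, good x -> (P (\bigcup_n A n) x <-> exists n, P (A n) x)}) ->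
  exists2 phi : Y -> euclidean R d, measurable_fun setT phi &
    forall A, measurable A -> {ae m, forall x, good x -> (P A x <-> A (phi x))}.
Proof.
move=> mP PT PC PU.
have /choice[u uP] (j : 'I_d) : exists u : Y -> R, measurable_fun setT u /\
    forall D : set R, measurable D ->
      {ae m, forall x, good x -> (P ((fun y => tnth y j) @^-1` D) x <-> D (u x))}.
  have mj : measurable_fun setT (fun y : euclidean R d => tnth y j).
    exact: (@measurable_tnth _ (measurableTypeR R) d j).
  by have [u mu_ uP] := real_point_realization mP PT PC PU mj; exists u.
pose phi x : euclidean R d := [tuple u j x | j < d].
have mphi : measurable_fun setT phi.
  apply/(@measurable_fun_tnthP _ _ Y (measurableTypeR R)) => j.
  by rewrite (_ : _ \o _ = u j); [exact: (uP j).1|apply/funext => x; rewrite /= tnth_mktuple].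
exists phi => // A mA.
suff : realized m good P id phi A by case.
move: A mA; apply: smallest_sub; first exact: realized_sigma_algebra.
rewrite -bigcup_seq; apply: bigcup_sub => j _ _ [D mD <-]; rewrite setTI; split.
  rewrite preimage_id -[X in measurable X]setTI.
  exact: (@measurable_tnth _ (measurableTypeR R) d j).
rewrite preimage_id; have := (uP j).2 D mD; apply: filterS => x h gx.
by rewrite (h gx) /= /phi tnth_mktuple.
Qed.

(** * The multiplier and the point map *)

Section positive_weight.
Context {R : realType} {d : nat}.
Local Open Scope complex_scope.
Local Notation X := (euclidean R d).
Local Notation mu := (lebesgue_euclidean R d).

(** A series of indicators over a sigma-finite cover, with coefficients making it bounded and
    integrable; [w <= 1] gives [w ^+ 2 <= w], hence square integrability. *)
Lemma positive_weight : exists w : X -> R,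
  [/\ measurable_fun setT w, forall x, 0 < w x, forall x, w x <= 1 &
      L2Linf (fun x => (w x)%:C)].
Proof.
have [F FT Foo] := sigma_finiteT mu.
have mF n : measurable (F n) by have [] := Foo n.
have mu0 n : 0 <= fine (mu (F n)) by rewrite fine_ge0.
(* Since [a n * (1 + mu (F n)) = 2^-(n+1)], each term is bounded by [2^-(n+1)] both pointwise and in
   integral. *)
pose a n : R := 1 / (2 ^ n.+1)%:R / (1 + fine (mu (F n))).
have a0 n : 0 < a n by rewrite !divr_gt0// ?ltr0n ?expn_gt0// ltr_pwDl.
have a_le n : a n * (1 + fine (mu (F n))) = 1 / (2 ^ n.+1)%:R.
  by rewrite /a mulfVK// gt_eqF// ltr_pwDl.
pose u n (x : X) : \bar R := (a n * \1_(F n) x)%:E.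
have u0 n x : (0 <= u n x)%E by rewrite lee_fin mulr_ge0// ltW.
have mu_ n : measurable_fun setT (u n).
  by apply/measurable_EFinP; apply: measurable_funM => //; exact: measurable_indic.
pose e x : \bar R := (\sum_(n <oo) u n x)%E.
have me : measurable_fun setT e.
  exact: (@ge0_emeasurable_sum _ _ _ setT u xpredT (fun n x _ _ => u0 n x) (fun n _ => mu_ n)).
have e1 x : (e x <= 1)%E.
  apply: (@le_trans _ _ (\sum_(n <oo) (1 / (2 ^ n.+1)%:R)%:E)%E); last exact: epsilon_trick0.
  apply: lee_nneseries => // n _; rewrite lee_fin -a_le ler_wpM2l ?(ltW (a0 n))//.
  by rewrite indicE; case: (_ \in _); [rewrite lerDl|rewrite addr_ge0].
have e0 x : (0 < e x)%E.
  have [n _ Fnx] : (\bigcup_n F n) x by rewrite -FT.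
  apply: (@lt_le_trans _ _ (u n x)); first by rewrite lte_fin indicE mem_set// mulr1.
  apply: le_trans (nneseries_lim_ge n.+1 _) => //.
  rewrite big_nat_recr//= leeDr//; exact: sume_ge0.
have eE x : e x = (fine (e x))%:E.
  by rewrite fineK// ge0_fin_numE ?(ltW (e0 x))// (le_lt_trans (e1 x))// ltry.
have inte : (\int[mu]_x e x <= 1)%E.
  rewrite integral_nneseries//.
  apply: (@le_trans _ _ (\sum_(n <oo) (1 / (2 ^ n.+1)%:R)%:E)%E); last exact: epsilon_trick0.
  apply: lee_nneseries => [n _ _|n _]; first exact: integral_ge0.
  have -> : (\int[mu]_x u n x = (a n)%:E * mu (F n))%E.
    under eq_integral do rewrite /u EFinM.
    rewrite ge0_integralZl//; last by rewrite lee_fin ltW.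
      by rewrite integral_indic// setIT.
    by apply/measurable_EFinP; exact: measurable_indic.
  have -> : mu (F n) = (fine (mu (F n)))%:E.
    by rewrite fineK// ge0_fin_numE//; have [] := Foo n.
  by rewrite -EFinM lee_fin -a_le ler_wpM2l ?(ltW (a0 n))// lerDr.
pose w x := fine (e x).
have mw : measurable_fun setT w by exact: measurableT_comp me.
have w0 x : 0 < w x by rewrite -lte_fin -eE.
have w1 x : w x <= 1 by rewrite -lee_fin -eE.
exists w; split => //; apply: (@L2Linf_intro _ _ _ 1).
- exact: measurable_cfun_real.
- by apply: aeW => x; rewrite sqn_real expr_le1// ltW.
apply: (@le_lt_trans _ _ 1%E); last exact: ltry.
apply: le_trans inte; apply: ge0_le_integral => //.
- by move=> x _; rewrite lee_fin sqn_ge0.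
- by apply/measurable_EFinP; apply: measurable_sqn; exact: measurable_cfun_real.
move=> x _; rewrite sqn_real expr2 eE lee_fin; exact: (ler_piMr (ltW (w0 x)) (w1 x)).
Qed.

Context (w : X -> R) (mw : measurable_fun setT w) (w0 : forall x, 0 < w x).

Lemma measurable_weight_level n : measurable [set y | n.+1%:R^-1 <= w y].
Proof.
have := @mw measurableT `[n.+1%:R^-1, +oo[%classic (measurable_itv _).
rewrite setTI; congr (measurable _); apply/seteqP.
by split => y; rewrite /= in_itv /= andbT.
Qed.

Lemma weight_level_cover x : exists n, n.+1%:R^-1 <= w x.
Proof.
exists (Num.bound (w x)^-1); rewrite -[leRHS]invrK lef_pV2 ?posrE ?invr_gt0//.
apply: le_trans (ltW (archi_boundP _)) _; first by rewrite invr_ge0 ltW.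
by rewrite ler_nat.
Qed.

Lemma L2Linf_weight_level n : L2Linf (fun x => (w x)%:C) ->
  L2Linf (\1_[set y | n.+1%:R^-1 <= w y] : X -> R[i]).
Proof.
move=> LW; set F := [set y | _]; pose W x := (w x)%:C : R[i].
have mF : measurable F by exact: measurable_weight_level.
have W_neq0 y : W y != 0 by rewrite fmorph_eq0 gt_eqF.
have -> : (\1_F : X -> R[i]) = (fun y => (\1_F y * (W y)^-1) * W y).
  by apply/funext => y; rewrite -mulrA mulVf ?mulr1.
apply: (@L2LinfM_bounded _ _ (fun y => \1_F y * (W y)^-1) W (n.+1%:R ^+ 2) _ _ LW).
  apply: measurable_cfunM; first exact: measurable_indicC.
  exact/measurable_cfunV/L2Linf_measurable.
apply: aeW => y; rewrite indicE; have [/set_mem Fy|_] := boolP (y \in F); last first.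
  by rewrite mul0r sqn0 sqr_ge0.
rewrite mul1r -(fmorphV (real_complex R)) sqn_real lerXn2r ?nnegrE ?invr_ge0 ?(ltW (w0 y))//.
by rewrite -[leRHS]invrK lef_pV2 ?posrE ?invr_gt0.
Qed.

End positive_weight.

Section floor_approximation.
Context {R : realFieldType}.

(** The sum counts the integers from 1 to [n] not exceeding [z]: a truncated floor, in a form that
    becomes a sum of indicators of level sets. *)
Lemma sum_threshold (n : nat) (z : R) : 0 <= z ->
  (n%:R <= z -> \sum_(k < n) ((k.+1%:R <= z)%R)%:R = n%:R :> R) /\
  (z <= n%:R -> z - 1 <= \sum_(k < n) ((k.+1%:R <= z)%R)%:R :> R /\
                \sum_(k < n) ((k.+1%:R <= z)%R)%:R <= z :> R).
Proof.
move=> z0; elim: n => [|n [IH1 IH2]].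
  by rewrite big_ord0; split=> // z0'; split=> //; lra.
rewrite big_ord_recr /=; split=> zn.
  rewrite zn IH1 ?natr1//; apply: le_trans zn; rewrite ler_nat//.
have [nz|zn'] := leP n.+1%:R z.
  have E : z = n.+1%:R by apply/eqP; rewrite eq_le zn.
  rewrite IH1; last by rewrite E ler_nat.
  by rewrite E -natr1 /=; split; lra.
rewrite addr0; have [nz|/ltW/IH2//] := leP n%:R z.
by rewrite IH1//; move: zn zn'; rewrite -natr1; split; lra.
Qed.

Lemma threshold_approx (n : nat) (y : R) : 0 <= y -> y <= 1 ->
  `|y - n.+1%:R^-1 * \sum_(k < n.+1) ((k.+1%:R <= n.+1%:R * y)%R)%:R| <= n.+1%:R^-1.
Proof.
move=> y0 y1; have n0 : 0 < n.+1%:R :> R by [].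
have z0 : 0 <= n.+1%:R * y by rewrite mulr_ge0.
have zn : n.+1%:R * y <= n.+1%:R by rewrite ler_piMr// ltW.
have [_ /(_ zn)[]] := sum_threshold n.+1 z0.
set s := \sum_(k < _) _ => h1 h2.
rewrite -(ler_pM2l n0) mulfV ?gt_eqF// -{1}(ger0_norm (ltW n0)) -normrM mulrBr mulrA.
rewrite mulfV ?gt_eqF// mul1r ler_norml; apply/andP; split; lra.
Qed.

End floor_approximation.

(** * Representation as a weighted composition *)

Section composition_operator.
Context {R : realType} {d : nat}.
Local Open Scope complex_scope.
Local Notation C := R[i].
Local Notation X := (euclidean R d).
Local Notation mu := (lebesgue_euclidean R d).
Context (T : (X -> C) -> (X -> C)) (hT : L2Linf_operator T) (hTinf : Linf_contraction T).
Implicit Types f g : X -> C.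
Hypothesis symT : forall f g, L2Linf f -> L2Linf g -> L2inner f (T g) = L2inner (T f) g.
Hypothesis sym2T : forall f g, L2Linf f -> L2Linf g ->
  L2inner (fun x => f x ^+ 2) (fun x => T g x ^+ 2) =
  L2inner (fun x => T f x ^+ 2) (fun x => g x ^+ 2).
Context (w : X -> R) (mw : measurable_fun setT w) (w0 : forall x, 0 < w x).
Hypothesis w1 : forall x, w x <= 1.
Let W x := (w x)%:C.
Hypothesis LW : L2Linf W.

Let TL := operator_L2Linf hT.
Let LTW : L2Linf (T W) := TL LW.

Lemma sqn_contraction f (M : R) : 0 <= M -> L2Linf f ->
  {ae mu, forall x, sqn (f x) <= M ^+ 2} -> {ae mu, forall x, sqn (T f x) <= M ^+ 2}.
Proof.
move=> M0 Lf /(cnormy_leP f M0) fM.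
by apply/(cnormy_leP (T f) M0); exact: le_trans (hTinf Lf) fM.
Qed.

Let W1 : {ae mu, forall x, sqn (T W x) <= 1}.
Proof.
have : {ae mu, forall x, sqn (T W x) <= 1 ^+ 2}.
  apply: sqn_contraction => //; apply: aeW => x.
  by rewrite sqn_real lerXn2r// nnegrE// ltW.
by rewrite expr1n.
Qed.

Context (phi : X -> X) (mphi : measurable_fun setT phi).
Hypothesis phiP : forall A, measurable A ->
  {ae mu, forall x, T W x != 0 -> (transported T w A x <-> A (phi x))}.

Lemma operator_indic A : measurable A ->
  {ae mu, forall x, T (fun y => \1_A y * W y) x = \1_A (phi x) * T W x}.
Proof.
move=> mA; have L1 := L2Linf_indicM mA LW.
apply: filterS3 (phiP mA) (transportedN hT sym2T mw w0 LW mA)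
  (operator_eq0 hT symT sym2T mw w0 LW L1) => x xA xN x0.
have [TW|TW] := eqVneq (T W x) 0; first by rewrite x0// TW mulr0.
have [tA Atr] := xA TW; have [Ax|nAx] := pselect (A (phi x)).
  by rewrite indicE mem_set// mul1r; exact: Atr.
by rewrite indicE memNset// mul0r xN// => /tA.
Qed.

Lemma operator_sum_indic (A : (set X)^nat) n : (forall k, measurable (A k)) ->
  {ae mu, forall x, T (fun y => (\sum_(k < n) \1_(A k) y) * W y) x =
                    (\sum_(k < n) \1_(A k) (phi x)) * T W x}.
Proof.
move=> mA; have L1 k := L2Linf_indicM (mA k) LW.
have Ls m : L2Linf (fun y => (\sum_(k < m) \1_(A k) y) * W y).
  elim: m => [|m IH].
    by under eq_fun do rewrite big_ord0; exact: L2LinfZ.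
  by under eq_fun do rewrite big_ord_recr mulrDl; exact: L2LinfD.
elim: n => [|n IH].
  have := operatorZ hT 0 LW; apply: filterS => x.
  rewrite big_ord0 => <-; congr (T _ x).
  by apply/funext => y; rewrite big_ord0.
have := operatorD hT (Ls n) (L1 n); apply: filterS3 IH (operator_indic (mA n)) => x E1 E2.
rewrite E1 E2 big_ord_recr mulrDl /= => <-; congr (T _ x).
by apply/funext => y; rewrite big_ord_recr mulrDl.
Qed.

(* [f] is uniformly approximated by averages of the indicators of its level
   sets, and the contraction property transfers this approximation to [T]. *)
Lemma operator_bounded (f : X -> R) : measurable_fun setT f ->
  (forall x, 0 <= f x) -> (forall x, f x <= 1) ->
  {ae mu, forall x, T (fun y => (f y)%:C * W y) x = (f (phi x))%:C * T W x}.
Proof.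
move=> mf f0 f1.
pose A n k := [set y | k.+1%:R <= n.+1%:R * f y].
have mA n k : measurable (A n k).
  have mnf : measurable_fun setT (fun y => n.+1%:R * f y).
    by apply: measurable_funM => //; exact: measurable_cst.
  have := mnf measurableT `[k.+1%:R, +oo[%classic (measurable_itv _).
  rewrite setTI; congr (measurable _); apply/seteqP.
  by split => y; rewrite /A /= in_itv /= andbT.
pose s n y : R := n.+1%:R^-1 * \sum_(k < n.+1) ((k.+1%:R <= n.+1%:R * f y)%R)%:R.
have sE n y : (s n y)%:C = (n.+1%:R^-1)%:C * \sum_(k < n.+1) \1_(A n k) y :> C.
  have CM (a b : R) : (a * b)%:C = a%:C * b%:C by exact: rmorphM.
  rewrite /s CM (rmorph_sum (real_complex R)) /=; congr (_ * _); apply: eq_bigr => k _.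
  by rewrite indicE (_ : (y \in A n k) = (k.+1%:R <= n.+1%:R * f y)) ?(rmorph_nat (real_complex R))//;
    apply/idP/idP => [/set_mem//|h]; exact/mem_set.
have sf n y : sqn ((f y)%:C - (s n y)%:C) <= n.+1%:R^-1 ^+ 2.
  rewrite -(rmorphB (real_complex R)) sqn_real -real_normK ?num_real//.
  by rewrite lerXn2r ?nnegrE// threshold_approx.
have Lf : L2Linf (fun y => (f y)%:C * W y).
  apply: (@L2LinfM_bounded _ _ (fun y => (f y)%:C) W 1 _ _ LW).
    exact: measurable_cfun_real mf.
  by apply: aeW => y; rewrite sqn_real expr_le1.
have Lsum n m : L2Linf (fun y => (\sum_(k < m) \1_(A n k) y) * W y).
  elim: m => [|m IH].
    by under eq_fun do rewrite big_ord0; exact: L2LinfZ.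
  by under eq_fun do rewrite big_ord_recr mulrDl; apply: L2LinfD => //; exact: L2Linf_indicM.
have Ls n : L2Linf (fun y => (s n y)%:C * W y).
  by under eq_fun do rewrite sE -mulrA; exact: (L2LinfZ _ (Lsum n n.+1)).
have Ts n : {ae mu, forall x, T (fun y => (s n y)%:C * W y) x = (s n (phi x))%:C * T W x}.
  have := operatorZ hT (n.+1%:R^-1)%:C (Lsum n n.+1).
  apply: filterS2 (operator_sum_indic n.+1 (mA n)) => x E1 E2.
  rewrite sE -mulrA -E1 -E2; congr (T _ x); apply/funext => y.
  by rewrite sE -mulrA.
(* The error has two parts of modulus at most [1/(n+1)]: [T] applied to [(f - s n) W], by
   contraction and [w <= 1], and [(s n - f)] at [phi x] times [T W]. The factor 4 comes from
   [sqnD_le]. *)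
have key n : {ae mu, forall x,
    sqn (T (fun y => (f y)%:C * W y) x - (f (phi x))%:C * T W x) <= 4 * n.+1%:R^-1 ^+ 2}.
  have : {ae mu, forall x, sqn (T (fun y => (f y)%:C * W y - (s n y)%:C * W y) x) <=
      n.+1%:R^-1 ^+ 2}.
    have n0 : 0 <= n.+1%:R^-1 :> R by rewrite invr_ge0.
    apply: (sqn_contraction n0 (L2LinfB Lf (Ls n))).
    apply: aeW => y; rewrite -mulrBl sqnM -[leRHS]mulr1 ler_pM ?sqn_ge0//.
    by rewrite sqn_real expr_le1// ltW.
  have E1 := operatorB hT Lf (Ls n).
  have E2 : {ae mu, forall x, T (fun y => (s n y)%:C * W y) x = (s n (phi x))%:C * T W x /\
      sqn (T W x) <= 1} by apply: filterS2 (Ts n) W1 => x; split.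
  apply: filterS3 E1 E2 => x E1x [E2x Wx]; rewrite E1x E2x => hx.
  set F := T _ x in hx *.
  have -> : F - (f (phi x))%:C * T W x =
    (F - (s n (phi x))%:C * T W x) + ((s n (phi x))%:C - (f (phi x))%:C) * T W x by ring.
  apply: le_trans (sqnD_le _ _) _.
  have : sqn (((s n (phi x))%:C - (f (phi x))%:C) * T W x) <= n.+1%:R^-1 ^+ 2.
    rewrite sqnM -[leRHS]mulr1 ler_pM ?sqn_ge0//.
    have sqnN (z : C) : sqn (- z) = sqn z by case: z => a b; rewrite /sqn /= !sqrrN.
    by rewrite -opprB sqnN; exact: sf.
  by move: hx; move: (sqn _) (sqn _) (n.+1%:R^-1 ^+ 2) => a b e; lra.
apply: filterS (ae_foralln key) => x kx.
apply/eqP; rewrite -subr_eq0 -sqn_eq0 eq_le sqn_ge0 andbT.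
apply/ler_addgt0Pl => e e0; rewrite addr0.
have [n ne] : exists n : nat, 4 / e < n.+1%:R.
  exists (Num.bound (4 / e)); apply: lt_le_trans (archi_boundP _) _.
    by rewrite divr_ge0// ltW.
  by rewrite ler_nat.
apply: le_trans (kx n) _; rewrite expr2 mulrA.
have n1 : n.+1%:R^-1 <= 1 :> R by rewrite invf_le1// ler1n.
apply: (@le_trans _ _ (4 * n.+1%:R^-1)).
  by rewrite ler_piMr// mulr_ge0// invr_ge0.
by rewrite ler_pdivrMr// mulrC -ler_pdivrMr// ltW.
Qed.

(** The value forced by the desired formula at [f = W]. *)
Definition multiplier x : C := T W x / W (phi x).

Let W_neq0 x : W x != 0. Proof. exact: weight_neq0. Qed.

Lemma measurable_multiplier : measurable_cfun multiplier.
Proof.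
apply: measurable_cfunM; first exact: L2Linf_measurable.
exact: measurable_cfunV (measurable_cfun_comp mphi (L2Linf_measurable LW)).
Qed.

(* Dividing by [D] brings the real and imaginary parts of [f] into [[-1, 1]]. *)
Let operator_ratio f : L2Linf f ->
  let D y : R := 1 + `|complex.Re (f y)| + `|complex.Im (f y)| in
  {ae mu, forall x, T (fun y => f y / (D y)%:C * W y) x =
                    f (phi x) / (D (phi x))%:C * T W x}.
Proof.
move=> Lf D; have [mf1 mf2] := L2Linf_measurable Lf.
have D1 y : 1 <= D y by rewrite /D -addrA lerDl addr_ge0.
have D0 y : 0 < D y by exact: lt_le_trans (D1 y).
have mD : measurable_fun setT D.
  apply: measurable_funD; last exact: measurableT_comp.
  by apply: measurable_funD; [exact: measurable_cst|exact: measurableT_comp].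
have mV : measurable_fun setT (fun y => (D y)^-1).
  under eq_fun do rewrite -powR_inv1 ?(ltW (D0 _))//.
  exact: (measurableT_comp (measurable_powR _) mD).
(* An affine rescaling: [v / D] lies in [[-1, 1]], so this lies in [[0, 1]], as [operator_bounded]
   demands. *)
pose part (v : X -> R) y := (D y + v y) / 2 / D y.
have key (v : X -> R) : measurable_fun setT v -> (forall y, `|v y| <= D y) ->
    L2Linf (fun y => (part v y)%:C * W y) /\
    {ae mu, forall x, T (fun y => (part v y)%:C * W y) x = (part v (phi x))%:C * T W x}.
  move=> mv vD.
  have mpv : measurable_fun setT (part v).
    apply: measurable_funM => //; apply: measurable_funM; last exact: measurable_cst.
    exact: measurable_funD.
  have p0 y : 0 <= part v y.
    have := vD y; rewrite ler_norml => /andP[v1 _].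
    by rewrite !divr_ge0// ?(ltW (D0 y))// -lerBlDl sub0r.
  have p1 y : part v y <= 1.
    have := vD y; rewrite ler_norml => /andP[_ v2].
    by rewrite !ler_pdivrMr// mul1r mulrDr mulr1 lerD2l.
  split; last exact: operator_bounded.
  apply: (@L2LinfM_bounded _ _ (fun y => (part v y)%:C) W 1 _ _ LW).
    exact: measurable_cfun_real mpv.
  by apply: aeW => y; rewrite sqn_real expr_le1.
have r1 y : `|complex.Re (f y)| <= D y by rewrite /D addrAC lerDr addr_ge0.
have r2 y : `|complex.Im (f y)| <= D y by rewrite /D lerDr addr_ge0.
have [La Ta] := key _ mf1 r1; have [Lb Tb] := key _ mf2 r2.
set a := part _ in La Ta; set b := part _ in Lb Tb.
pose I : C := Complex 0 1.
(* With [a] and [b] the rescaled real and imaginary parts, [f / D = 2 a + 2 i b - (1 + i)]. *)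
have dec y (z : C) : f y / (D y)%:C * z =
    2 * ((a y)%:C * z) + ((2 * I) * ((b y)%:C * z) + (- (1 + I)) * z).
  rewrite !mulrA -!mulrDl; congr (_ * _).
  have -> : ((D y)%:C)^-1 = ((D y)^-1)%:C by rewrite (fmorphV (real_complex R)).
  have d0 : D y != 0 by rewrite gt_eqF.
  rewrite /a /b /part /I; move: (D y) d0 (f y) => D' d0 [u v].
  by apply/eqP; rewrite eq_complex /=; apply/andP; split; apply/eqP; field.
case: (hT) => _ _ lin.
have LI := L2LinfZ (- (1 + I)) LW.
have Lg : L2Linf (fun y => (2 * I) * ((b y)%:C * W y) + (- (1 + I)) * W y).
  by apply: L2LinfD => //; exact: L2LinfZ.
have /aeqP E1 := lin 2 _ _ La Lg; have /aeqP E2 := lin (2 * I) _ _ Lb LI.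
have E3 := operatorZ hT (- (1 + I)) LW.
have TE : (fun y => f y / (D y)%:C * W y) =
    (fun y => 2 * ((a y)%:C * W y) + ((2 * I) * ((b y)%:C * W y) + (- (1 + I)) * W y)).
  by apply/funext => y; exact: dec.
have E4 : {ae mu, forall x, T (fun y => f y / (D y)%:C * W y) x =
    2 * T (fun y => (a y)%:C * W y) x + ((2 * I) * T (fun y => (b y)%:C * W y) x +
    (- (1 + I)) * T W x)}.
  by rewrite TE; apply: filterS3 E1 E2 E3 => x -> -> ->.
by apply: filterS3 E4 Ta Tb => x -> -> ->; rewrite dec.
Qed.

(** With [v = W / D], rearranging [f * (v W) = (f / D * W) * W] gives
    [T f * T (v W) = T (f / D * W) * T W], where all factors but [T f] are known. Cancel where [T W]
    is nonzero; elsewhere [T f] vanishes as well. *)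
Lemma operatorE f : L2Linf f -> {ae mu, forall x, T f x = multiplier x * f (phi x)}.
Proof.
move=> Lf; pose D y : R := 1 + `|complex.Re (f y)| + `|complex.Im (f y)|.
have [mf1 mf2] := L2Linf_measurable Lf.
have D1 y : 1 <= D y by rewrite /D -addrA lerDl addr_ge0.
have D0 y : 0 < D y by exact: lt_le_trans (D1 y).
have mV : measurable_fun setT (fun y => (D y)^-1).
  have mD : measurable_fun setT D.
    apply: measurable_funD; last exact: measurableT_comp.
    by apply: measurable_funD; [exact: measurable_cst|exact: measurableT_comp].
  under eq_fun do rewrite -powR_inv1 ?(ltW (D0 _))//.
  exact: (measurableT_comp (measurable_powR _) mD).
pose v y := w y / D y.
have mv : measurable_fun setT v by exact: measurable_funM.
have v0 y : 0 <= v y by rewrite divr_ge0// ltW.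
have v1 y : v y <= 1 by rewrite ler_pdivrMr// mul1r (le_trans (w1 y)).
have Lv : L2Linf (fun y => (v y)%:C * W y).
  apply: (@L2LinfM_bounded _ _ (fun y => (v y)%:C) W 1 _ _ LW).
    exact: measurable_cfun_real mv.
  by apply: aeW => y; rewrite sqn_real expr_le1.
have Dc (y : X) : (D y)%:C != 0 :> C by rewrite fmorph_eq0 gt_eqF.
have vE y : (v y)%:C = W y / (D y)%:C.
  by rewrite /v (rmorphM (real_complex R)) /= (fmorphV (real_complex R)).
have Lr : L2Linf (fun y => f y / (D y)%:C * W y).
  have -> : (fun y => f y / (D y)%:C * W y) = (fun y => (v y)%:C * f y).
    by apply/funext => y; rewrite vE; ring.
  apply: (@L2LinfM_bounded _ _ (fun y => (v y)%:C) f 1 _ _ Lf).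
    exact: measurable_cfun_real mv.
  by apply: aeW => y; rewrite sqn_real expr_le1.
have h y : f y * ((v y)%:C * W y) = f y / (D y)%:C * W y * W y.
  by rewrite vE; ring.
have E1 := operator_prod hT sym2T mw w0 LW Lf Lv Lr LW h.
have E2 : {ae mu, forall x, T (fun y => (v y)%:C * W y) x = (v (phi x))%:C * T W x /\
    T (fun y => f y / (D y)%:C * W y) x = f (phi x) / (D (phi x))%:C * T W x}.
  by apply: filterS2 (operator_bounded mv v0 v1) (operator_ratio Lf) => x; split.
apply: filterS3 E1 E2 (operator_eq0 hT symT sym2T mw w0 LW Lf) => x E [Ev Er] f0.
rewrite Ev Er in E.
have [TW|TW] := eqVneq (T W x) 0; first by rewrite f0// /multiplier TW !mul0r.
rewrite vE in E; rewrite /multiplier.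
have Dx := Dc (phi x); have Wx := W_neq0 (phi x).
apply: (mulIf (mulf_neq0 (mulf_neq0 Wx (invr_neq0 Dx)) TW)).
rewrite E; field; by rewrite Dx Wx.
Qed.

(** Contractivity is tested on indicators of the levels of [w], which belong to the space and
    exhaust it, in place of the constant 1. *)
Lemma sqn_multiplier_le1 : {ae mu, forall x, sqn (multiplier x) <= 1}.
Proof.
pose F n := [set y | n.+1%:R^-1 <= w y].
have LF n : L2Linf (\1_(F n) : X -> C) by exact: L2Linf_weight_level.
have hF n : {ae mu, forall x, sqn (multiplier x) * (\1_(F n) (phi x)) <= 1}.
  have : {ae mu, forall x, sqn (T (\1_(F n) : X -> C) x) <= 1 ^+ 2}.
    apply: sqn_contraction => //; apply: aeW => y.
    by rewrite indicE; case: (_ \in _); rewrite ?sqn1 ?sqn0 ?expr1n.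
  apply: filterS2 (operatorE (LF n)) => x ->; rewrite sqnM expr1n !indicE.
  by case: (_ \in _); rewrite ?sqn1 ?sqn0.
apply: filterS (ae_foralln hF) => x hx.
have [n Fn] := weight_level_cover w0 (phi x).
by have := hx n; rewrite indicE mem_set// mulr1.
Qed.

End composition_operator.

(** * Consequences of symmetry for the multiplier and the point map *)

Section symmetric_weighted_composition.
Context {R : realType} {d : nat}.
Local Open Scope complex_scope.
Local Notation C := R[i].
Local Notation X := (euclidean R d).
Local Notation mu := (lebesgue_euclidean R d).
Context (T : (X -> C) -> (X -> C)) (hT : L2Linf_operator T).
Implicit Types f g : X -> C.
Hypothesis symT : forall f g, L2Linf f -> L2Linf g -> L2inner f (T g) = L2inner (T f) g.
Hypothesis sym2T : forall f g, L2Linf f -> L2Linf g ->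
  L2inner (fun x => f x ^+ 2) (fun x => T g x ^+ 2) =
  L2inner (fun x => T f x ^+ 2) (fun x => g x ^+ 2).
Context (w : X -> R) (mw : measurable_fun setT w) (w0 : forall x, 0 < w x).
Let W x := (w x)%:C.
Hypothesis LW : L2Linf W.
Context (h : X -> C) (phi : X -> X).
Hypotheses (mh : measurable_cfun h) (h1 : {ae mu, forall x, sqn (h x) <= 1}).
Hypothesis mphi : measurable_fun setT phi.
Hypothesis TE : forall f, L2Linf f -> {ae mu, forall x, T f x = h x * f (phi x)}.

Let TL := operator_L2Linf hT.
Let cM (a b : C) : conjc (a * b) = conjc a * conjc b. Proof. exact: rmorphM. Qed.
Let W_neq0 x : W x != 0. Proof. exact: weight_neq0. Qed.
Let conjW x : conjc (W x) = W x. Proof. exact: conjc_real. Qed.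

Let LTW : L2Linf (T W) := TL LW.

(* With [F = conj h * W ^ 2], comparing the symmetry of [T] tested on [F] and
   [W g] with the second order symmetry tested on [W] gives [T F = (T W) ^ 2]. *)
Lemma multiplier_conj : {ae mu, forall x, h x != 0 -> conjc (h (phi x)) = h x}.
Proof.
have LW2 := L2LinfX 1 LW.
pose F x := conjc (h x) * W x ^+ 2.
have LF : L2Linf F.
  apply: (@L2LinfM_bounded _ _ (fun x => conjc (h x)) (fun x => W x ^+ 2) 1 _ _ LW2).
    exact: measurable_cfun_conj.
  by apply: filterS h1 => x; rewrite sqn_conj.
pose k x := T F x - T W x ^+ 2.
have LTW2 := L2LinfX 1 LTW; have LTF := TL LF.
have Lk : L2Linf k by exact: L2LinfB.
have LWk := L2LinfM LW Lk; have LTk := TL Lk; have LTWk := TL LWk.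
have : {ae mu, forall x, k x = 0}.
  apply: (L2inner_weight_eq0 mw w0 Lk LWk).
  rewrite L2innerBl// -symT// -L2inner_sqr_polar//; apply/eqP; rewrite subr_eq0; apply/eqP.
  apply: eq_L2inner_conjM => //; first exact: L2LinfM.
  apply: filterS3 (TE LWk) (TE LW) (TE Lk) => x -> -> ->.
  by rewrite /F cM conjcK expr2 !cM !conjW; ring.
apply: filterS3 (TE LF) (TE LW) => x TFx TWx; rewrite /k TFx TWx /F => /eqP.
rewrite subr_eq0 exprMn [h x ^+ 2]expr2 -mulrA => /eqP/mulfI kx /kx.
by apply: mulIf; rewrite expf_neq0.
Qed.

Let D n := [set x | n.+1%:R^-1 <= sqn (h x)].
Let F n := [set x | n.+1%:R^-1 <= w x].

Let mD n : measurable (D n).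
Proof.
have := @measurable_sqn _ _ _ mh measurableT `[n.+1%:R^-1, +oo[%classic (measurable_itv _).
by rewrite setTI; congr (measurable _); apply/seteqP; split => y; rewrite /D /= in_itv /= andbT.
Qed.

Let mF n : measurable (F n). Proof. exact: measurable_weight_level. Qed.

Let mpre A : measurable A -> measurable (phi @^-1` A).
Proof. by move=> mA; rewrite -[X in measurable X]setTI; exact: mphi. Qed.

Let h_neq0 n x : D n x -> h x != 0.
Proof. by move=> Dx; rewrite -sqn_eq0 gt_eqF// (lt_le_trans _ Dx). Qed.

Let L2Linf_indic_fin A : measurable A -> L2Linf (\1_A : X -> C) -> (mu A < +oo)%E.
Proof.
move=> mA /L2Linf_sqn/integrable_lty => /(_ measurableT); congr (_ < _)%E.
rewrite -[in RHS](setIT A) -integral_indic//; apply: eq_integral => x _.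
by rewrite /= !indicE; case: (_ \in _); rewrite ?sqn1 ?sqn0.
Qed.

Let muF n A : measurable A -> A `<=` F n -> (mu A < +oo)%E.
Proof.
move=> mA AF; apply: le_lt_trans (L2Linf_indic_fin (mF n) (L2Linf_weight_level mw w0 n LW)).
by apply: le_measure => //; exact/mem_set.
Qed.

Let cintegral_indic A : measurable A -> cintegral (\1_A : X -> C) = (fine (mu A))%:C.
Proof.
move=> mA; rewrite /cintegral /Rintegral; congr Complex.
  congr fine; rewrite -[in RHS](setIT A) -integral_indic//; apply: eq_integral => x _.
  by rewrite /= !indicE; case: (_ \in _).
by rewrite integral0_eq// => x _; rewrite indicE; case: (_ \in _).
Qed.

Let iI (A B : set X) x : \1_(A `&` B) x = \1_A x * \1_B x :> C.
Proof. by rewrite indicI. Qed.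

Let iP (A : set X) x : \1_(phi @^-1` A) x = \1_A (phi x) :> C.
Proof.
by rewrite !indicE; congr (_%:R); congr nat_of_bool; apply/idP/idP => /set_mem Ax; exact/mem_set.
Qed.

(* Symmetry of [T] tested on [1_(D n `&` K `&` F n) / conj h] and
   [1_(A `&` F n)]; the sets [D n] and [F n] only ensure integrability. *)
Let measure_sym_level n A K : measurable A -> measurable K ->
  mu (D n `&` (K `&` F n) `&` phi @^-1` (A `&` F n)) =
  mu (D n `&` phi @^-1` (K `&` F n) `&` (A `&` F n)).
Proof.
move=> mA mK; have mKF := measurableI _ _ mK (mF n); have mAF := measurableI _ _ mA (mF n).
set S1 := (X in mu X = _); set S2 := (X in _ = mu X).
have mS1 : measurable S1 by apply: measurableI; [exact: measurableI|exact: mpre].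
have mS2 : measurable S2 by apply: measurableI => //; apply: measurableI => //; exact: mpre.
have LFn := L2Linf_weight_level mw w0 n LW.
have Lg : L2Linf (\1_(A `&` F n) : X -> C).
  by rewrite indicI; exact: (L2Linf_indicM mA LFn).
pose b x := \1_(D n `&` K) x * (conjc (h x))^-1.
pose f x := b x * \1_(F n) x.
have Lf : L2Linf f.
  apply: (@L2LinfM_bounded _ _ b (\1_(F n)) n.+1%:R _ _ LFn).
    apply: measurable_cfunM; first exact/measurable_indicC/measurableI.
    exact/measurable_cfunV/measurable_cfun_conj.
  apply: aeW => x; rewrite /b indicE.
  have [/set_mem[Dx _]|_] := boolP (x \in D n `&` K); last by rewrite mul0r sqn0.
  have sx : 0 < sqn (h x) by apply: lt_le_trans Dx; rewrite invr_gt0.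
  by rewrite mul1r sqnV sqn_conj -[leRHS]invrK lef_pV2 ?posrE ?invr_gt0.
have [LTf LTg] := (TL Lf, TL Lg).
suff : (fine (mu S1))%:C = (fine (mu S2))%:C :> C.
  move=> /complexI E; rewrite -[LHS]fineK ?ge0_fin_numE//; last first.
    by apply: (@muF n) => // x [[_ []]].
  by rewrite E fineK// ge0_fin_numE//; apply: (@muF n) => // x [_ []].
rewrite -!cintegral_indic//.
transitivity (L2inner f (T (\1_(A `&` F n) : X -> C))).
  apply: eq_cintegral; first exact: measurable_indicC.
    by apply: measurable_cfunM; [apply: measurable_cfun_conj|]; exact: L2Linf_measurable.
  apply: filterS (TE Lg) => x ->; rewrite /f /b.
  have -> : \1_S1 x = \1_(D n `&` K) x * \1_(F n) x * \1_(A `&` F n) (phi x) :> C.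
    by rewrite /S1 setIA iI iP !iI; ring.
  have [Dx|nD] := pselect (D n x); last first.
    by rewrite iI [\1_(D n) x]indicE memNset// !mul0r conjc0 mul0r.
  have hx := h_neq0 Dx; have cI (B : set X) : conjc (\1_B x : C) = \1_B x.
    by rewrite indicE; case: (_ \in _); rewrite ?conjc1 ?conjc0.
  by rewrite !cM !cI conjc_inv conjcK; field.
rewrite symT//; apply: eq_cintegral.
- by apply: measurable_cfunM; [apply: measurable_cfun_conj|]; exact: L2Linf_measurable.
- exact: measurable_indicC.
apply: filterS2 (TE Lf) multiplier_conj => x -> hx; rewrite /f /b.
have cI (B : set X) y : conjc (\1_B y : C) = \1_B y.
  by rewrite indicE; case: (_ \in _); rewrite ?conjc1 ?conjc0.
have [h0|hn0] := eqVneq (h x) 0.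
  rewrite h0 mul0r conjc0 mul0r indicE memNset// => -[[/h_neq0 + _] _].
  by rewrite h0 eqxx.
have hE := hx hn0; rewrite hE.
(* Where [h] does not vanish, [h (phi x)] and [h x] have equal modulus, so the levels of [h] are
   invariant under [phi]. *)
have DD : (phi x \in D n) = (x \in D n).
  by apply/idP/idP => /set_mem Dx; apply/mem_set; move: Dx; rewrite /D /= -hE sqn_conj.
have iD : \1_(D n) (phi x) = \1_(D n) x :> C by rewrite !indicE DD.
rewrite !cM !cI conjc_inv /S2 !(iI, iP) iD.
by field; rewrite conjc_eq0.
Qed.

(** Continuity from below along the levels of [h] and [w]. The choice [K = setT] expresses
    invariance of the measure on [{h <> 0}], while [A = phi @^-1] (~[K)] leads to
    [phi (phi x) = x]. *)
Lemma measure_symmetric A K : measurable A -> measurable K ->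
  mu ([set x | h x != 0] `&` K `&` phi @^-1` A) =
  mu ([set x | h x != 0] `&` phi @^-1` K `&` A).
Proof.
move=> mA mK; have mKF n := measurableI _ _ mK (mF n); have mAF n := measurableI _ _ mA (mF n).
have Dle m n : (m <= n)%N -> D m `<=` D n.
  move=> mn x; apply: le_trans; rewrite lef_pV2 ?posrE// ler_nat ltnS//.
have Fle m n : (m <= n)%N -> F m `<=` F n.
  move=> mn x; apply: le_trans; rewrite lef_pV2 ?posrE// ler_nat ltnS//.
have Dcov x : h x != 0 -> exists n, D n x.
  rewrite -sqn_eq0 => sx; have s0 : 0 < sqn (h x) by rewrite lt_neqAle eq_sym sx sqn_ge0.
  exists (Num.bound (sqn (h x))^-1); rewrite /D /= -[leRHS]invrK lef_pV2 ?posrE ?invr_gt0//.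
  apply: le_trans (ltW (archi_boundP _)) _; first by rewrite invr_ge0 sqn_ge0.
  by rewrite ler_nat.
have Fcov x : exists n, F n x by exact: weight_level_cover.
pose S1 n := D n `&` (K `&` F n) `&` phi @^-1` (A `&` F n).
pose S2 n := D n `&` phi @^-1` (K `&` F n) `&` (A `&` F n).
have mS1 n : measurable (S1 n) by apply: measurableI; [exact: measurableI|exact: mpre].
have mS2 n : measurable (S2 n).
  by apply: measurableI => //; apply: measurableI => //; exact: mpre.
have U1 : [set x | h x != 0] `&` K `&` phi @^-1` A = \bigcup_n S1 n.
  apply/seteqP; split=> x; last by case=> n _ [[/h_neq0 ? [? _]] [? _]].
  move=> [[/Dcov[i Di] Kx] Ax]; have [[j Fj] [l Fl]] := (Fcov x, Fcov (phi x)).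
  exists (maxn i (maxn j l)) => //; split; [split; [|split=> //]|split=> //].
  - by apply: Dle Di; exact: leq_maxl.
  - by apply: Fle Fj; rewrite !leq_max leqnn !orbT.
  - by apply: Fle Fl; rewrite !leq_max leqnn !orbT.
have U2 : [set x | h x != 0] `&` phi @^-1` K `&` A = \bigcup_n S2 n.
  apply/seteqP; split=> x; last by case=> n _ [[/h_neq0 ? [? _]] [? _]].
  move=> [[/Dcov[i Di] Kx] Ax]; have [[j Fj] [l Fl]] := (Fcov x, Fcov (phi x)).
  exists (maxn i (maxn j l)) => //; split; [split; [|split=> //]|split=> //].
  - by apply: Dle Di; exact: leq_maxl.
  - by apply: Fle Fl; rewrite !leq_max leqnn !orbT.
  - by apply: Fle Fj; rewrite !leq_max leqnn !orbT.
have nd1 : nondecreasing_seq S1.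
  move=> m n mn; apply/subsetPset => x [[/(Dle _ _ mn) ? [? /(Fle _ _ mn) ?]] [? /(Fle _ _ mn) ?]].
  by [].
have nd2 : nondecreasing_seq S2.
  move=> m n mn; apply/subsetPset => x [[/(Dle _ _ mn) ? [? /(Fle _ _ mn) ?]] [? /(Fle _ _ mn) ?]].
  by [].
rewrite U1 U2.
have c1 := @nondecreasing_cvg_mu _ _ _ mu S1 mS1 (bigcupT_measurable _ mS1) nd1.
have c2 := @nondecreasing_cvg_mu _ _ _ mu S2 mS2 (bigcupT_measurable _ mS2) nd2.
have E : mu \o S1 = mu \o S2 by apply/funext => n; exact: measure_sym_level.
rewrite E in c1; exact: cvg_unique c1 c2.
Qed.

Lemma multiplier_phiK : {ae mu, forall x, h x != 0 -> phi (phi x) = x}.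
Proof.
have half K : measurable K -> {ae mu, forall x, h x != 0 -> K x -> K (phi (phi x))}.
  move=> mK; have mA : measurable (phi @^-1` (~` K)) by exact: (mpre (measurableC mK)).
  exists ([set x | h x != 0] `&` K `&` phi @^-1` (phi @^-1` (~` K))); split.
  - apply: measurableI; last exact: mpre.
    apply: measurableI => //.
    rewrite [X in measurable X](_ : _ = ~` [set x | h x = 0]).
      by apply: measurableC; apply: measurable_cfun_eq => //; exact: measurable_cfun_cst.
    by apply/seteqP; split => x /= /eqP.
  - have := measure_symmetric mA mK => ->.
    rewrite [X in mu X](_ : _ = set0) ?measure0//.
    by apply/seteqP; split => // x [[_ +] +].
  - move=> x /= /not_implyP[hx /not_implyP[Kx nK]]; exact.
(* Rational half-spaces and their complements separate points; encoding them by natural numbers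
   allows countably many a.e. statements to be combined. *)
pose I := ('I_d * rat)%type.
have key : {ae mu, forall x, forall n : nat, if (unpickle n : option I) is Some (j, q) then
    h x != 0 -> (tnth x j < ratr q) = (tnth (phi (phi x)) j < ratr q) else True}.
  apply: ae_foralln => n; case: (unpickle n) => [[j q]|]; last exact: aeW.
  have mU : measurable [set y : X | tnth y j < ratr q].
    have := @measurable_tnth _ (measurableTypeR R) d j measurableT `]-oo, (ratr q : R)[%classic
      (measurable_itv _).
    by rewrite setTI; congr (measurable _); apply/seteqP; split => y; rewrite /= in_itv.
  apply: filterS2 (half _ mU) (half _ (measurableC mU)) => x h2 h3 hx.
  by apply/idP/idP => [/(h2 hx)//|xq]; apply: contrapT => /(h3 hx); exact.
apply: filterS key => x kx hx; apply: eq_from_tnth => j.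
have kjq q : (tnth x j < ratr q) = (tnth (phi (phi x)) j < ratr q).
  by have := kx (pickle (j, q)); rewrite pickleK => /(_ hx).
apply/eqP; rewrite eq_le !leNgt; apply/andP; split; apply/negP => /rat_in_itvoo[q].
  rewrite in_itv /= => /andP[xq qx].
  have {}xq : tnth (phi (phi x)) j < ratr q by rewrite -kjq; exact: xq.
  by have := lt_trans xq qx; rewrite ltxx.
rewrite in_itv /= => /andP[xq qx].
have {}xq : tnth x j < ratr q by rewrite kjq; exact: xq.
by have := lt_trans xq qx; rewrite ltxx.
Qed.

End symmetric_weighted_composition.

Lemma measure_ae_eq {d} {T : measurableType d} {R : realType}
    (mu : {measure set T -> \bar R}) (A B : set T) :
  measurable A -> measurable B -> {ae mu, forall x, A x <-> B x} -> mu A = mu B.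
Proof.
move=> mA mB AB; rewrite -[A]setIT -[B]setIT -!integral_indic//.
apply: ge0_ae_eq_integral => //.
- by apply/measurable_EFinP; exact: measurable_indic.
- by apply/measurable_EFinP; exact: measurable_indic.
apply: filterS AB => x [AB BA] _; rewrite !indicE; congr ((nat_of_bool _)%:R%:E).
by apply/idP/idP => /set_mem ?; apply/mem_set; [exact: AB|exact: BA].
Qed.

Theorem theorem3 (R : realType) (d : nat) (hd : (1 <= d)%N)
    (c : R) (hc : 0 < c)
    (H : completeNormedModType R[i]) (dot : {dot H for Num.conj})
    (Phi : H) (B : nat -> (euclidean R d -> R[i]) -> H)
    (hB : quadratic_fock dot c Phi B)
    (T : (euclidean R d -> R[i]) -> (euclidean R d -> R[i]))
    (hT : L2Linf_operator T)
    (hTinf : Linf_contraction T) (hT2 : L2_bounded T) :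
  essentially_self_adjoint dot (Gamma2 B T) <->
  exists (E : set (euclidean R d)) (h : euclidean R d -> R[i])
      (phi : euclidean R d -> euclidean R d),
    [/\ measurable E,
        measurable_cfun h /\ (cnorm +oo%E h <= 1)%E,
        [/\ involution_on E phi, measurable_fun E phi &
            measure_preserving_on E phi],
        {ae lebesgue_euclidean R d,
          forall x, E x -> conjc (h x) = h (phi x)} &
        forall f, L2Linf f ->
          T f = (fun x => \1_E x * h x * f (phi x))
            %[ae lebesgue_euclidean R d]].
Proof.
split=> [saT|[E [h [phi [mE [mh h1] [iphi mphi pphi] hphi TE]]]]]; last first.
  exact: (weighted_involution_self_adjoint hc hB hT hTinf mE mh h1 iphi mphi pphi hphi TE).
have symT := L2inner_sym hc hB hT hTinf saT.
have sym2T := L2inner_sqr_sym hc hB hT hTinf saT.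
have [w [mw w0 w1 LW]] := positive_weight (R := R) (d := d).
set mu := lebesgue_euclidean R d.
pose W x := real_complex R (w x).
have [phi mphi phiP] := euclidean_point_realization (m := mu)
  (good := [set x | T W x != 0]) (P := transported T w)
  (fun A mA => measurable_transported hT LW mA) (transported_setT T w)
  (fun A mA => transportedC hT sym2T mw w0 LW mA)
  (fun A mA => transported_bigcup hT symT sym2T mw w0 LW mA).
pose h := multiplier T w phi.
have mh : measurable_cfun h by apply: measurable_multiplier.
have TE := operatorE hT hTinf symT sym2T mw w0 w1 LW phiP.
have h1 := sqn_multiplier_le1 hT hTinf symT sym2T mw w0 w1 LW phiP.
have hconj := multiplier_conj hT symT sym2T mw w0 LW mh h1 TE.
have phiK := multiplier_phiK hT symT sym2T mw w0 LW mh h1 mphi TE.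
have musym := measure_symmetric hT symT sym2T mw w0 LW mh h1 mphi TE.
pose E0 := [set x | h x != 0].
have mE0 : measurable E0.
  rewrite (_ : E0 = ~` [set x | h x = 0]).
    by apply: measurableC; apply: measurable_cfun_eq => //; exact: measurable_cfun_cst.
  by apply/seteqP; split => x /= /eqP.
have mpre (psi : euclidean R d -> euclidean R d) A : measurable_fun setT psi ->
    measurable A -> measurable (psi @^-1` A).
  by move=> mpsi mA; rewrite -[X in measurable X]setTI; exact: mpsi.
(* This differs from [{h <> 0}] by a null set only, but here [phi] maps [E] into itself and is an
   involution at every point. *)
pose E := E0 `&` phi @^-1` E0 `&` [set x | phi (phi x) = x].
have mE : measurable E.
  apply: measurableI; first exact: measurableI mE0 (mpre _ _ mphi mE0).
  rewrite (_ : [set x | _] = \bigcap_(j in [set: 'I_d])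
      [set x | real_complex R (tnth (phi (phi x)) j) = real_complex R (tnth x j)]).
    apply: fin_bigcap_measurable => // j _.
    have mj : measurable_fun setT (fun y : euclidean R d => tnth y j : R).
      exact: (@measurable_tnth _ (measurableTypeR R) d j).
    apply: measurable_cfun_eq; apply: measurable_cfun_real => //.
    exact: (measurableT_comp mj (measurableT_comp mphi mphi)).
  apply/seteqP; split=> x /=; first by move=> px j _; rewrite /= px.
  by move=> xj; apply: eq_from_tnth => j; exact: (complexI (xj j Logic.I)).
have E_E0 : {ae mu, forall x, E0 x <-> E x}.
  apply: filterS2 hconj phiK => x hx px; split=> [E0x|[[]]//].
  split; last exact: px.
  by split => //; rewrite /E0 /= -(conjc_eq0 (h (phi x))) hx.
exists E, h, phi; split => //.
- split=> //; apply/(cnormy_leP h ler01); rewrite expr1n; exact: h1.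
- split.
  + split=> [x [[E0x E0px] px]|x [] //].
    by split; [split; [|rewrite /= px]|rewrite /= px].
  + exact: measurable_funTS.
  + move=> A mA AE.
    have mpA : measurable (phi @^-1` A) by exact: mpre.
    have -> : mu (E `&` phi @^-1` A) = mu (E0 `&` phi @^-1` A).
      apply: measure_ae_eq; [exact: measurableI|exact: measurableI|].
      by apply: filterS E_E0 => x Ex; split=> -[/Ex ? ?].
    (* With [K = setT] the symmetry relation turns the measure of the preimage into that of [A] cut
       down to [E0], which contains [A]. *)
    have := musym A setT mA measurableT.
    rewrite preimage_setT !setIT => ->.
    by congr (mu _); apply/seteqP; split=> [x []//|x Ax]; split => //; have [[]] := AE x Ax.
- by apply: filterS2 hconj E_E0 => x hx xE /xE/hx <-; rewrite conjcK.
move=> f Lf; apply/aeqP; apply: filterS2 (TE f Lf) E_E0 => x -> xE.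
have [Ex|nE] := pselect (E x); first by rewrite indicE mem_set// mul1r.
rewrite indicE memNset// !mul0r; have [h0|/xE//] := eqVneq (h x) 0.
by rewrite [multiplier _ _ _ _]h0 mul0r.
Qed.
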